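(* Let $K,P,Q,m,n$ be as in the context. Let $P_m$ be the set of minor final $\pi$-roots of $P$, and for $\tau\in P_m$ let $\delta_\tau$ be the order of $\tau$. Set $$I_m:=1-\sum_{\tau\in P_m}(\delta_\tau+1).$$ Then $I_m\le I(P,Q)$. Moreover, $$I(P,P_yQ)=\deg(P)-\sum_{\tau\in P_m}|D_\tau^P|\,(1+\delta_\tau).$$ Here $P_y=\partial_yP$, $\deg(P)$ is the degree of $P$ in $y$, and $I(F,G):=\deg_x(\operatorname{Res}_y(F,G))$ is the $x$-degree of the resultant of $F$ and $G$ as polynomials in $y$.
   Context: **Notation.** $K$ is an algebraically closed field of characteristic $0$, $\mathbb N=\{1,2,\dots\}$, $L=K[x,y]$, $L^{(l)}=K[x^{\pm 1/l},y]$ for $l\in\mathbb N$, and $[F,G]=\partial_xF\,\partial_yG-\partial_xG\,\partial_yF$. A direction is a pair $(\rho,\sigma)\in\mathbb Z^2$ of coprime integers. Put $v_{\rho,\sigma}(i/l,j)=\rho i/l+\sigma j$. For $0\neq F\in L^{(l)}$, $v_{\rho,\sigma}(F)$ is the maximum of $v_{\rho,\sigma}$ over the support of $F$, and $\ell_{\rho,\sigma}(F)$ is the sum of the terms of $F$ at which this maximum is attained. If $\rho>0$, $\mathrm{st}_{\rho,\sigma}(F)$ (resp. $\mathrm{en}_{\rho,\sigma}(F)$) is the point of the support of $\ell_{\rho,\sigma}(F)$ with smallest (resp. largest) second coordinate. $K((x^{-1/l}))$ is the field of formal Laurent series in $x^{-1/l}$, $\pi$ is a variable, and $\deg_x$ of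 an element of $K[\pi]((x^{-1/l}))$ is its largest exponent of $x$ with nonzero coefficient. $F(\tau)$ means that $y$ is replaced by $\tau$ in $F$. **The pair.** $m,n>1$ are coprime integers. A pair $(P_0,Q_0)$ in $L$ is a standard $(m,n)$-pair if $[P_0,Q_0]\in K^\times$, $\frac{v_{1,1}(P_0)}{v_{1,1}(Q_0)}=\frac{v_{1,0}(P_0)}{v_{1,0}(Q_0)}=\frac mn$, $v_{1,-1}(\mathrm{en}_{1,0}(P_0))<0$ and $v_{1,-1}(\mathrm{st}_{1,0}(P_0))<0$. It is a minimal pair if it is a counterexample to the two-dimensional Jacobian Conjecture over $K$ and $\gcd(v_{1,1}(P_0),v_{1,1}(Q_0))$ is minimal among all such counterexamples. We fix $(P_0,Q_0)$ which is a minimal pair and a standard $(m,n)$-pair such that, for some integers $0<a<b$, $\mathrm{en}_{1,0}(P_0)=m(a,b)$, $\mathrm{en}_{1,0}(Q_0)=n(a,b)$, $\ell_{1,1}(P_0)=x^{am}y^{bm}$ and $\ell_{1,1}(Q_0)=x^{an}y^{bn}$. Let $\psi$ be the automorphism of $L$ with $\psi(y)=y$, $\psi(x)=x+y$, and put $P=\psi(P_0)$, $Q=\psi(Q_0)$, so $\ell_{1,1}(P)=(x+y)^{ma}y^{mb}$, $\ell_{1,1}(Q)=(x+y)^{na}y^{nb}$, and $P,Q$ are monic in $y$. **$\pi$-roots.** For $F\in\{P,Q\}$, $\mathcal R(F)$ is the multiset of roots of $F$ as a polynomial in $y$ (with multiplicity); all roots lie in $K((x^{-1/l}))$ for a suitable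 $l$, fixed and large enough. For $\tau=\sum_{j>j_0}a_jx^j+\pi x^{j_0}\in K[\pi,x^{\pm1/l}]$, $D_\tau^F$ is the sub-multiset of those $\alpha\in\mathcal R(F)$ whose coefficients of $x^j$ equal $a_j$ for all $j>j_0$; then $\tau$ is called the $\pi$-approximation of $\alpha$ up to $x^{j_0}$. $\tau$ is a $\pi$-root of $F$, of order $j_0$, if $D_\tau^F\neq\emptyset$. Put $\lambda_\tau^F=\deg_x(F(\tau))$, $\lambda_\tau=\lambda_\tau^P$, and let $f_{F,\tau}(\pi)\in K[\pi]$ be the coefficient of $x^{\lambda^F_\tau}$ in $F(\tau)$. A $\pi$-root $\tau$ of $F$ is final if $f_{F,\tau}$ has no multiple roots and $\deg f_{F,\tau}>1$. A final $\pi$-root $\tau$ of $P$ is minor if $\lambda_\tau=0$ and major if $\lambda_\tau>0$. **Genericity.** After adding a suitable constant of $K$ to $P$, we assume: for every $\pi$-root $\tau$ of $P$ with $\lambda_\tau=0$, $f_{P,\tau}$ has no multiple roots and $f_{P,\tau},f_{Q,\tau}$ are coprime; moreover $(0,0)$ lies in the supports of both $P$ and $Q$. *)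

(* Defs.v *)
From HB Require Import structures.
From mathcomp Require Import all_boot all_order all_algebra.
From mathcomp Require Import ring lra.
From mathcomp Require Import finmap.
From mathcomp Require Import mathcomp_extra boolp classical_sets functions.
From mathcomp Require Import cardinality fsbigop.

Set Implicit Arguments.
Unset Strict Implicit.
Unset Printing Implicit Defensive.

Import Order.TTheory GRing.Theory Num.Theory.
Local Open Scope classical_set_scope.
Local Open Scope ring_scope.

(* ------------------------------------------------------------------------ *)
(* K[x,y] is {poly {poly K}}: the outer variable is y, the inner one is x,   *)
(* so that F`_j`_i is the coefficient of x^i y^j.                            *)
(* ------------------------------------------------------------------------ *)

Section BivariatePolynomials.
Variable K : fieldType.
Implicit Types (F G : {poly {poly K}}) (p : nat * nat) (rho sigma : int).

Definition xvar : {poly {poly K}} := ('X)%:P.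
Definition yvar : {poly {poly K}} := 'X.

Definition dx F : {poly {poly K}} := map_poly (@deriv K) F.
Definition dy F : {poly {poly K}} := F^`().
Definition jac F G := dx F * dy G - dx G * dy F.

(* F(A, B): x is replaced by A and y by B *)
Definition subst2 (A B F : {poly {poly K}}) : {poly {poly K}} :=
  (map_poly (fun c : {poly K} => (map_poly (fun k : K => k%:P%:P) c).[A]) F).[B].

(* (i, j) stands for x^i y^j; the list is ordered by increasing j *)
Definition supp F : seq (nat * nat) :=
  [seq (i, j) | j <- iota 0 (size F),
                i <- [seq i <- iota 0 (size F`_j) | F`_j`_i != 0]].

Definition vpt rho sigma p : int := rho * p.1%:Z + sigma * p.2%:Z.

(* meaningful for F != 0 only; the default value 0 is used when F = 0 *)
Definition val rho sigma F : int :=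
  let vs := [seq vpt rho sigma p | p <- supp F] in
  \big[Num.max/head 0 vs]_(k <- vs) k.

Definition ell rho sigma F : {poly {poly K}} :=
  \sum_(p <- supp F | vpt rho sigma p == val rho sigma F)
     (F`_p.2`_p.1)%:P%:P * xvar ^+ p.1 * yvar ^+ p.2.

(* For 0 < rho the points of supp (ell rho sigma F) have pairwise distinct
   second coordinates, hence the first (last) point listed is the one with
   smallest (largest) second coordinate. *)
Definition st rho sigma F : nat * nat := head (0, 0)%N (supp (ell rho sigma F)).
Definition en rho sigma F : nat * nat := last (0, 0)%N (supp (ell rho sigma F)).

Definition jacobian_pair F G := exists2 c : K, c != 0 & jac F G = c%:P%:P.

(* The endomorphism x |-> F, y |-> G of K[x,y] has Jacobian in K^* but is not
   an automorphism. *)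
Definition JC_counterexample F G :=
  jacobian_pair F G /\ ~ bijective (subst2 F G).

Definition minimal_pair F G :=
  JC_counterexample F G /\
  forall F' G', JC_counterexample F' G' ->
    gcdz (val 1 1 F) (val 1 1 G) <= gcdz (val 1 1 F') (val 1 1 G').

Definition standard_pair (m n : nat) F G :=
  [/\ jacobian_pair F G,
      (val 1 1 F)%:~R / (val 1 1 G)%:~R = m%:R / n%:R :> rat,
      (val 1 0 F)%:~R / (val 1 0 G)%:~R = m%:R / n%:R :> rat,
      vpt 1 (-1) (en 1 0 F) < 0 &
      vpt 1 (-1) (st 1 0 F) < 0].

(* I(F, G) = deg_x Res_y(F, G); meaningful when the resultant is nonzero *)
Definition intersection_number F G : nat := (size (resultant F G)).-1.

Definition no_multiple_root (f : {poly K}) := forall r : K, (mup r f <= 1)%N.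

End BivariatePolynomials.

(* ------------------------------------------------------------------------ *)
(* puiseux R is the union over l >= 1 of the rings R((x^{-1/l})): a series   *)
(* is given by its coefficient function q |-> (coefficient of x^q), whose    *)
(* support is bounded above and has a common denominator.                    *)
(* ------------------------------------------------------------------------ *)

Section Puiseux.
Variable R : comNzRingType.
Implicit Types (f g : rat -> R) (s t u : nat -> R) (l N d : nat).

Definition puiseux_supp f := exists l N,
  (0 < l)%N /\ forall q, f q != 0 -> q <= N%:R /\ q * l%:R \is a Num.int.

Record puiseux := Puiseux { pcoef :> rat -> R; pcoefP : puiseux_supp pcoef }.

HB.instance Definition _ := gen_eqMixin puiseux.
HB.instance Definition _ := gen_choiceMixin puiseux.

Lemma puiseuxP (f g : puiseux) : pcoef f = pcoef g -> f = g.
Proof.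
by case: f g => [f fP] [g gP] /= E; subst g; congr Puiseux; apply: Prop_irrelevance.
Qed.

(* Cauchy product; only finitely many terms are nonzero *)
Definition pmul_fun f g (q : rat) : R :=
  \sum_(p \in [set: rat]) f p * g (q - p).

(* The series \sum_i s_i x^{N - i/l} *)
Definition pser l N s (q : rat) : R :=
  let z := (N%:R - q) * l%:R in
  if z \is a Num.nat then s (Num.truncn z) else 0.

Lemma pserE l N s i : (0 < l)%N -> pser l N s (N%:R - i%:R / l%:R) = s i.
Proof.
move=> l0; have l0' : l%:R != 0 :> rat by rewrite pnatr_eq0 -lt0n.
rewrite /pser /=.
have -> : (N%:R - (N%:R - i%:R / l%:R)) * l%:R = i%:R :> rat by field.
by rewrite natr_nat natrK.
Qed.

Lemma pserP l N s q : (0 < l)%N ->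
  (exists i, q = N%:R - i%:R / l%:R) \/ pser l N s q = 0.
Proof.
move=> l0; have l0' : l%:R != 0 :> rat by rewrite pnatr_eq0 -lt0n.
rewrite /pser; case: ifP => [/natrP[i Ei]|]; last by right.
by left; exists i; rewrite -Ei; field.
Qed.

Lemma pser_supp l N s : (0 < l)%N -> puiseux_supp (pser l N s).
Proof.
move=> l0; have l0' : l%:R != 0 :> rat by rewrite pnatr_eq0 -lt0n.
exists l, N; split=> // q.
case: (pserP N s q l0) => [[i ->] _|->]; last by rewrite eqxx.
split; first by rewrite gerBl divr_ge0.
have -> : (N%:R - i%:R / l%:R) * l%:R = (N * l)%:R - i%:R :> rat.
  by rewrite natrM; field.
by rewrite rpredB // intr_nat // natr_nat.
Qed.

Lemma pser_repr f : puiseux_supp f -> exists l0 N0, (0 < l0)%N /\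
  forall k N, (0 < k)%N -> (N0 <= N)%N -> exists s, f = pser (l0 * k) N s.
Proof.
move=> [l [N0 [l0 fP]]]; exists l, N0; split=> // k N k0 leN.
exists (fun i => f (N%:R - i%:R / (l * k)%:R)); apply/funext => q.
have lk0 : (0 < l * k)%N by rewrite muln_gt0 l0.
have lk0' : (l * k)%:R != 0 :> rat by rewrite pnatr_eq0 -lt0n.
rewrite /pser; case: ifPn => [/natrP[i Ei]|nn].
  by rewrite Ei natrK -Ei mulfK // subKr.
apply/eqP; apply: contraNT nn => /fP[leq qi].
rewrite natrEint; apply/andP; split; last first.
  by rewrite mulr_ge0 ?ler0n // subr_ge0 (le_trans leq) // ler_nat.
rewrite natrM mulrBl !mulrA rpredB //.
  by rewrite -!natrM intr_nat // natr_nat.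
by rewrite rpredM // intr_nat // natr_nat.
Qed.

Lemma pser_repr2 f g : puiseux_supp f -> puiseux_supp g ->
  exists l N s t, [/\ (0 < l)%N, f = pser l N s & g = pser l N t].
Proof.
move=> /pser_repr[l1 [N1 [h1 H1]]] /pser_repr[l2 [N2 [h2 H2]]].
have [s Es] := H1 l2 (N1 + N2)%N h2 (leq_addr _ _).
have [t Et] := H2 l1 (N1 + N2)%N h1 (leq_addl _ _).
exists (l1 * l2)%N, (N1 + N2)%N, s, t; split=> //; first by rewrite muln_gt0 h1.
by rewrite Et mulnC.
Qed.

Lemma pser_repr3 f g h :
  puiseux_supp f -> puiseux_supp g -> puiseux_supp h ->
  exists l N s t u,
    [/\ (0 < l)%N, f = pser l N s, g = pser l N t & h = pser l N u].
Proof.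
move=> /pser_repr[l1 [N1 [h1 H1]]] /pser_repr[l2 [N2 [h2 H2]]]
       /pser_repr[l3 [N3 [h3 H3]]].
set N := (N1 + N2 + N3)%N.
have [||s Es] := H1 (l2 * l3)%N N; rewrite ?muln_gt0 ?h2 ?h3 //.
  by rewrite /N -addnA leq_addr.
have [||t Et] := H2 (l1 * l3)%N N; rewrite ?muln_gt0 ?h1 ?h3 //.
  by rewrite /N -addnA addnCA leq_addr.
have [||u Eu] := H3 (l1 * l2)%N N; rewrite ?muln_gt0 ?h1 ?h2 //.
  by rewrite /N leq_addl.
exists (l1 * (l2 * l3))%N, N, s, t, u; split=> //.
- by rewrite !muln_gt0 h1 h2 h3.
- by rewrite Et mulnCA.
- by rewrite Eu mulnC mulnA.
Qed.

Let conv s t d : R := \sum_(i < d.+1) s i * t (d - i)%N.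

Let convE D s t d : (d < D)%N ->
  conv s t d = ((\poly_(i < D) s i) * (\poly_(i < D) t i))`_d.
Proof.
move=> dD; rewrite coefM; apply: eq_bigr => i _.
have lei : (i <= d)%N by rewrite -ltnS.
by rewrite !coef_poly (leq_ltn_trans lei dD) (leq_ltn_trans (leq_subr _ _) dD).
Qed.

Let convC s t : conv s t = conv t s.
Proof. by apply/funext => d; rewrite !(@convE d.+1) // mulrC. Qed.

Let convA s t u : conv s (conv t u) = conv (conv s t) u.
Proof.
apply/funext => d.
pose pl s := \poly_(i < d.+1) s i : {poly R}.
transitivity ((pl s * (pl t * pl u))`_d).
  rewrite coefM; apply: eq_bigr => i _; congr (_ * _).
    by rewrite coef_poly ltn_ord.
  by rewrite (@convE d.+1) // ltnS leq_subr.
rewrite mulrA coefM; apply: eq_bigr => i _; congr (_ * _).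
  by rewrite (@convE d.+1).
by rewrite coef_poly ltnS leq_subr.
Qed.

Lemma pmul_pser l N M s t : (0 < l)%N ->
  pmul_fun (pser l N s) (pser l M t) = pser l (N + M) (conv s t).
Proof.
move=> l0; have l0' : l%:R != 0 :> rat by rewrite pnatr_eq0 -lt0n.
apply/funext => q; rewrite /pmul_fun.
have [[d ->]|nq] := pselect (exists d, q = (N + M)%:R - d%:R / l%:R); last first.
  have [[d Eq]|->] := pserP (N + M) (conv s t) q l0; first by case: nq; exists d.
  rewrite fsbig1 // => p _.
  have [[i Ei]|->] := pserP N s p l0; last by rewrite mul0r.
  have [[j Ej]|->] := pserP M t (q - p) l0; last by rewrite mulr0.
  case: nq; exists (i + j)%N.
  by rewrite -[q](subrK p) Ej Ei !natrD; field.
rewrite pserE //.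
pose e i : rat := N%:R - i%:R / l%:R.
have einj : injective e.
  move=> i j /addrI/oppr_inj/(divIf l0')/eqP.
  by rewrite eqr_nat => /eqP.
pose r := [seq e i | i <- iota 0 d.+1].
have ur : uniq r by rewrite map_inj_uniq // iota_uniq.
rewrite (fsbigTE (seq_fset tt r)); last first.
  move=> p; rewrite seq_fsetE => pr.
  have [[i Ei]|->] := pserP N s p l0; last by rewrite mul0r.
  have [[j Ej]|->] := pserP M t ((N + M)%:R - d%:R / l%:R - p) l0; last by rewrite mulr0.
  case/negP: pr; apply/mapP; exists i => //.
  rewrite mem_iota /= add0n ltnS.
  have Eij : (d%:R = (i + j)%:R :> rat).
    rewrite natrD; have /(congr1 (fun z => z * l%:R)) := Ej.
    rewrite Ei natrD => H.
    have : (N%:R + M%:R - d%:R / l%:R - (N%:R - i%:R / l%:R)) * l%:R =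
           M%:R * l%:R - d%:R + i%:R :> rat by field.
    rewrite H mulrBl divfK // => H2; lra.
  by move/eqP: Eij; rewrite eqr_nat => /eqP ->; rewrite leq_addr.
rewrite (perm_big r); last first.
  by apply: uniq_perm => [||p]; rewrite ?fset_uniq ?seq_fsetE.
rewrite big_map -[iota 0 d.+1]/(index_iota 0 d.+1) big_mkord /conv.
apply: eq_bigr => i _; rewrite pserE //; congr (_ * _).
have -> : (N + M)%:R - d%:R / l%:R - e i = M%:R - (d - i)%:R / l%:R.
  have led : (i <= d)%N by rewrite -ltnS.
  by rewrite (natrB _ led) /e natrD; field.
by rewrite pserE.
Qed.

Lemma padd_pser l N s t : (0 < l)%N ->
  (fun q => pser l N s q + pser l N t q) = pser l N (fun i => s i + t i).
Proof. by move=> l0; apply/funext => q; rewrite /pser; case: ifP; rewrite ?addr0. Qed.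

Lemma padd_supp (f g : puiseux) : puiseux_supp (fun q => f q + g q).
Proof.
have [l [N [s [t [l0 -> ->]]]]] := pser_repr2 (pcoefP f) (pcoefP g).
by rewrite padd_pser //; apply: pser_supp.
Qed.

Lemma popp_supp (f : puiseux) : puiseux_supp (fun q => - f q).
Proof.
case: (pcoefP f) => l [N [l0 H]]; exists l, N; split=> // q.
by rewrite oppr_eq0; apply: H.
Qed.

Lemma pmul_supp (f g : puiseux) : puiseux_supp (pmul_fun f g).
Proof.
have [l [N [s [t [l0 -> ->]]]]] := pser_repr2 (pcoefP f) (pcoefP g).
by rewrite pmul_pser //; apply: pser_supp.
Qed.

Lemma pmono_supp (q : rat) (c : R) :
  puiseux_supp (fun p => if p == q then c else 0).
Proof.
exists `|denq q|%N, `|Num.ceil q|%N; split; first by rewrite absz_gt0 denq_neq0.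
move=> p; have [-> _|_] := eqVneq p q; last by rewrite eqxx.
split.
  rewrite (le_trans (ceil_ge q)) // natr_absz ler_int; exact: ler_norm.
rewrite natr_absz gtr0_norm ?denq_gt0 // -{1}[q]divq_num_den mulfVK ?intr_eq0 //.
Qed.

(* c x^q *)
Definition pmono (q : rat) (c : R) : puiseux := Puiseux (pmono_supp q c).

Definition padd (f g : puiseux) : puiseux := Puiseux (padd_supp f g).
Definition popp (f : puiseux) : puiseux := Puiseux (popp_supp f).
Definition pmul (f g : puiseux) : puiseux := Puiseux (pmul_supp f g).

Lemma paddA : associative padd.
Proof. by move=> f g h; apply/puiseuxP/funext => q /=; rewrite addrA. Qed.
Lemma paddC : commutative padd.
Proof. by move=> f g; apply/puiseuxP/funext => q /=; rewrite addrC. Qed.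
Lemma padd0 : left_id (pmono 0 0) padd.
Proof. by move=> f; apply/puiseuxP/funext => q /=; rewrite if_same add0r. Qed.
Lemma paddN : left_inverse (pmono 0 0) popp padd.
Proof. by move=> f; apply/puiseuxP/funext => q /=; rewrite if_same addNr. Qed.

HB.instance Definition _ := GRing.isZmodule.Build puiseux paddA paddC padd0 paddN.

Lemma pmulA : associative pmul.
Proof.
move=> f g h; apply/puiseuxP => /=.
have [l [N [s [t [u [l0 -> -> ->]]]]]] :=
  pser_repr3 (pcoefP f) (pcoefP g) (pcoefP h).
by rewrite !pmul_pser // convA addnA.
Qed.

Lemma pmulC : commutative pmul.
Proof.
move=> f g; apply/puiseuxP => /=.
have [l [N [s [t [l0 -> ->]]]]] := pser_repr2 (pcoefP f) (pcoefP g).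
by rewrite !pmul_pser // convC.
Qed.

Lemma pmul1 : left_id (pmono 0 1) pmul.
Proof.
move=> f; apply/puiseuxP/funext => q /=; rewrite /pmul_fun.
rewrite (fsbigTE [fset (0 : rat)]%fset); last first.
  by move=> p; rewrite inE => /negPf ->; rewrite mul0r.
by rewrite big_seq_fset1 eqxx mul1r subr0.
Qed.

Lemma pmulDl : left_distributive pmul padd.
Proof.
move=> f g h; apply/puiseuxP => /=.
have [l [N [s [t [u [l0 -> -> ->]]]]]] :=
  pser_repr3 (pcoefP f) (pcoefP g) (pcoefP h).
rewrite padd_pser // !pmul_pser // padd_pser //; congr pser.
apply/funext => d; rewrite /conv -big_split /=.
by apply: eq_bigr => i _; rewrite mulrDl.
Qed.

Lemma pone_neq0 : pmono 0 1 != pmono 0 0.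
Proof.
apply/eqP => /(congr1 (fun f : puiseux => f 0)) /= /eqP.
by rewrite oner_eq0.
Qed.

HB.instance Definition _ := GRing.Zmodule_isComNzRing.Build puiseux
  pmulA pmulC pmul1 pmulDl pone_neq0.

(* a polynomial in x, seen as a series *)
Definition pofpoly (p : {poly R}) : puiseux :=
  \sum_(i < size p) pmono i%:R p`_i.

(* largest exponent with nonzero coefficient; 0 for the zero series *)
Definition pdeg (f : puiseux) : rat :=
  xget 0 [set q | f q != 0 /\ forall r, q < r -> f r = 0].

End Puiseux.

(* ------------------------------------------------------------------------ *)
(* Roots, pi-roots.  The variable pi is the variable 'X of {poly K}, so that *)
(* puiseux {poly K} is the union over l of the rings K[pi]((x^{-1/l})).      *)
(* ------------------------------------------------------------------------ *)

Section PiRoots.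
Variable K : closedFieldType.
Implicit Types (F G : {poly {poly K}}) (rs : seq (puiseux K)).

(* rs is the multiset of roots of F, as a polynomial in y *)
Definition root_multiset F rs :=
  let F' := map_poly (@pofpoly K) F in
  F' = (lead_coef F')%:P * \prod_(alpha <- rs) ('X - alpha%:P).

Lemma pconst_supp (f : puiseux K) : puiseux_supp (fun q => (f q)%:P).
Proof.
case: (pcoefP f) => l [N [l0 H]]; exists l, N; split=> // q.
by rewrite polyC_eq0; apply: H.
Qed.

Definition pconst (f : puiseux K) : puiseux {poly K} := Puiseux (pconst_supp f).

(* (A, j0) stands for A + pi x^{j0}, see pi_series.  No denominator l is fixed;
   this does not affect final pi-roots: if fpoly has two distinct roots, two
   roots in D_tau differ at x^{j0}, so j0 lies in (1/l)Z as soon as all the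
   exponents of the roots do. *)
Definition pi_approx := (puiseux K * rat)%type.

Implicit Types tau : pi_approx.

Definition pi_order tau : rat := tau.2.

Definition pi_series tau : puiseux {poly K} := pconst tau.1 + pmono tau.2 'X.

(* F(tau) *)
Definition psubst F tau : puiseux {poly K} :=
  (map_poly (fun c : {poly K} => pconst (pofpoly c)) F).[pi_series tau].

(* D_tau^F, where rs is the multiset of roots of F *)
Definition Dtau rs tau : seq (puiseux K) :=
  [seq alpha : puiseux K <- rs |
    `[< forall j : rat, tau.2 < j -> alpha j = tau.1 j >]].

(* All exponents of tau.1 are > tau.2; tau.1 is then a finite sum. *)
Definition pi_root rs tau :=
  (forall j : rat, j <= tau.2 -> tau.1 j = 0) /\ Dtau rs tau <> [::].

Definition lambda F tau : rat := pdeg (psubst F tau).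

Definition fpoly F tau : {poly K} := psubst F tau (lambda F tau).

Definition final_pi_root F rs tau :=
  [/\ pi_root rs tau, no_multiple_root (fpoly F tau) &
      (1 < (size (fpoly F tau)).-1)%N].

Definition minor_pi_root F rs tau := final_pi_root F rs tau /\ lambda F tau = 0.

Definition generic_pair F G rs :=
  (forall tau, pi_root rs tau -> lambda F tau = 0 ->
     no_multiple_root (fpoly F tau) /\ coprimep (fpoly F tau) (fpoly G tau)) /\
  ((0, 0)%N \in supp F /\ (0, 0)%N \in supp G).

End PiRoots.

(* Main.v *)
Require Import Defs.
From HB Require Import structures.
From mathcomp Require Import all_boot all_order all_algebra perm.
From mathcomp Require Import ring lra zify.
From mathcomp Require Import finmap.
From mathcomp Require Import boolp classical_sets functions cardinality fsbigop.

Set Implicit Arguments.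
Unset Strict Implicit.
Unset Printing Implicit Defensive.

Import Order.TTheory GRing.Theory Num.Theory.
Local Open Scope classical_set_scope.
Local Open Scope ring_scope.

(** Write theta for x d/dx, acting on Puiseux series, and [P, Q] = c for the
    Jacobian condition.  If alpha is a root of P in y, the chain rule gives
    P_y(alpha) theta(Q(alpha)) = - c x, hence
    deg P_y(alpha) + deg Q(alpha) = 1 as soon as deg Q(alpha) is not 0.  The
    roots with deg Q(alpha) = 0 are those in the sets D_tau of the minor
    pi-roots tau, and there deg P_y(alpha) = - delta_tau ([pdeg_at_root]).
    Since P is monic, the resultant of P and G is up to sign the product of the
    G(alpha) ([resultant_roots]), and summing over the roots of P gives the
    formula for I(P, P_y Q).

    Both halves of the description of the exceptional roots compare the top
    coefficients of the Jacobian in the coordinates (x, pi), where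
    y = tau + pi x^j: with f and g the leading coefficients of P(tau) and
    Q(tau), the polynomial lambda_P f g' - lambda_Q f' g is constant
    ([bracket_top]).  If tau is minor, then lambda_P = 0 while f' is not
    constant, so lambda_Q = 0, and as f and g are coprime Q has degree 0 at
    every root in D_tau.  Conversely let deg Q(alpha) = 0 and follow the
    approximations of alpha to lower and lower orders.  As long as lambda_P and
    lambda_Q are positive, g vanishes at the coefficient of alpha, so the
    constant is 0 and the multiplicities of this coefficient in f and g are in
    the ratio lambda_P : lambda_Q.  This ratio is m : n at the start, because
    the degrees in y are, and the relation preserves it.  When lambda_P reaches
    0, the number of roots of P still close to alpha is therefore a multiple of
    m, hence at least 2, and the pi-root reached is minor ([degree0_minor]).

    For the inequality, P_y is split by the Newton-Puiseux theorem.  At a root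
    beta of P_y one has theta(P(beta)) = x P_x(beta) and
    P_x(beta) Q_y(beta) = c, so deg P(beta) = 1 - deg Q_y(beta) unless
    deg P(beta) = 0; in the latter case beta agrees with a minor tau up to its
    order, and deg Q_y(beta) <= - delta_tau ([pdeg_at_critical]).  The degrees
    of the Q_y(beta) add up to the degree of a nonzero polynomial in x, namely a
    resultant, so their sum is nonnegative, and tau is approximated by
    |D_tau| - 1 roots of P_y.  This bounds the sum of the deg P(beta), which is
    also the sum of the deg P_y(alpha), and subtracting the latter from
    I(P, P_y Q) leaves I(P, Q). *)

(** * Coefficients and degree of Puiseux series *)



Section PuiseuxCoefficients.
Variable R : comNzRingType.
Implicit Types (f g : puiseux R) (p q r : rat).

Lemma pcoef0 q : (0 : puiseux R) q = 0.
Proof. by rewrite /= if_same. Qed.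

Lemma pcoef1 q : (1 : puiseux R) q = (q == 0)%:R.
Proof. by rewrite /=; case: eqP. Qed.

Lemma pcoefD f g q : (f + g) q = f q + g q.
Proof. by []. Qed.

Lemma pcoefN f q : (- f) q = - f q.
Proof. by []. Qed.

Lemma pcoefB f g q : (f - g) q = f q - g q.
Proof. by []. Qed.

Lemma pcoefE p c q : pmono p c q = if q == p then c else 0 :> R.
Proof. by []. Qed.

Lemma puiseux_eqP f g : (forall q, f q = g q) -> f = g.
Proof. by move=> E; apply/puiseuxP/funext. Qed.

Lemma pcoef_sum (I : Type) (s : seq I) (P : pred I) (F : I -> puiseux R) q :
  (\sum_(i <- s | P i) F i) q = \sum_(i <- s | P i) F i q.
Proof. by apply: (big_morph (fun f : puiseux R => f q)); rewrite ?pcoef0. Qed.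

(** Both factors have exponents bounded above and on a common grid, which leaves
    finitely many ways to write [q] as a sum. *)
Lemma pcoefM_finite f g q : exists S : {fset rat},
  forall p, p \notin S -> f p = 0 \/ g (q - p) = 0.
Proof.
have [l [N [s [t [l0 -> ->]]]]] := pser_repr2 (pcoefP f) (pcoefP g).
have l0' : l%:R != 0 :> rat by rewrite pnatr_eq0 -lt0n.
pose d := Num.truncn (((N + N)%:R - q) * l%:R).
exists (seq_fset tt [seq (N%:R - i%:R / l%:R : rat) | i <- iota 0 d.+1]) => p.
rewrite seq_fsetE => pS.
have [[i Ei]|->] := pserP N s p l0; last by left.
have [[j Ej]|->] := pserP N t (q - p) l0; last by right.
case/negP: pS; apply/mapP; exists i => //; rewrite mem_iota /= add0n ltnS /d.
have -> : ((N + N)%:R - q) * l%:R = (i + j)%:R.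
  by rewrite -[q](subrK p) Ej Ei !natrD; field.
by rewrite natrK leq_addr.
Qed.

Lemma pcoefM f g q : (f * g) q = \sum_(p \in [set: rat]) f p * g (q - p).
Proof. by []. Qed.

Lemma pcoefM_fset (S : {fset rat}) f g q :
  (forall p, p \notin S -> f p = 0 \/ g (q - p) = 0) ->
  (f * g) q = \sum_(p <- S) f p * g (q - p).
Proof.
move=> HS; rewrite pcoefM (fsbigTE S) // => p /HS[]->; by rewrite ?mul0r ?mulr0.
Qed.

Lemma pcoef_mulmono f p c q : (f * pmono p c) q = f (q - p) * c.
Proof.
rewrite (@pcoefM_fset [fset (q - p)]%fset) => [|r].
  by rewrite big_seq_fset1 pcoefE subKr eqxx.
rewrite inE => rqp; right; rewrite pcoefE; case: eqP => // E.
by case/eqP: rqp; rewrite -E subKr.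
Qed.

Lemma pmonoM p q a b : pmono p a * pmono q b = pmono (p + q) (a * b) :> puiseux R.
Proof.
apply: puiseux_eqP => r; rewrite pcoef_mulmono !pcoefE subr_eq.
by case: ifP; rewrite ?mul0r.
Qed.

Lemma pmono0 p : pmono p 0 = 0 :> puiseux R.
Proof. by apply: puiseux_eqP => q; rewrite pcoefE pcoef0 if_same. Qed.

Lemma pmonoD p a b : pmono p (a + b) = pmono p a + pmono p b :> puiseux R.
Proof. by apply: puiseux_eqP => q; rewrite pcoefD !pcoefE; case: ifP; rewrite ?addr0. Qed.

(** [pdle a f] bounds the degree of [f] without excluding the zero series, and
    [f a] is then the leading coefficient at level [a], possibly zero. *)
Definition pdle (a : rat) f := forall r, a < r -> f r = 0.

Lemma pdle0 a : pdle a 0.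
Proof. by move=> r _; rewrite pcoef0. Qed.

Lemma pdle1 : pdle 0 1.
Proof. by move=> r r0; rewrite pcoef1 gt_eqF. Qed.

Lemma pdleN a f : pdle a f -> pdle a (- f).
Proof. by move=> fa r ar; rewrite pcoefN fa ?oppr0. Qed.

Lemma pdle_sum (I : Type) (s : seq I) (P : pred I) (F : I -> puiseux R) a :
  (forall i, P i -> pdle a (F i)) -> pdle a (\sum_(i <- s | P i) F i).
Proof. by move=> H r ar; rewrite pcoef_sum big1 // => i /H ->. Qed.

Lemma pdle_mono p c : pdle p (pmono p c).
Proof. by move=> r pr; rewrite pcoefE gt_eqF. Qed.

Lemma pdleM a b f g : pdle a f -> pdle b g -> pdle (a + b) (f * g).
Proof.
move=> fa gb r abr; rewrite (@pcoefM_fset fset0) ?big_seq_fset0 // => p _.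
have [/fa|pa] := ltP a p; first by left.
by right; apply: gb; lra.
Qed.

Lemma pcoefM_top a b f g : pdle a f -> pdle b g -> (f * g) (a + b) = f a * g b.
Proof.
move=> fa gb; rewrite (@pcoefM_fset [fset a]%fset) => [|p].
  by rewrite big_seq_fset1 [a + b]addrC addrK.
rewrite inE; have [pa _|/fa fp _|//] := ltgtP p a; last by left.
by right; apply: gb; lra.
Qed.

Lemma pdle_prod (I : Type) (s : seq I) (F : I -> puiseux R) (a : I -> rat) :
  (forall i, pdle (a i) (F i)) ->
  pdle (\sum_(i <- s) a i) (\prod_(i <- s) F i) /\
  (\prod_(i <- s) F i) (\sum_(i <- s) a i) = \prod_(i <- s) F i (a i).
Proof.
move=> H; elim: s => [|i s [IH1 IH2]].
  by rewrite !big_nil pcoef1 eqxx; split=> //; apply: pdle1.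
rewrite !big_cons; split; first exact: pdleM.
by rewrite pcoefM_top // IH2.
Qed.

Lemma pdleX a f k : pdle a f -> pdle (a *+ k) (f ^+ k) /\ (f ^+ k) (a *+ k) = f a ^+ k.
Proof.
move=> fa; elim: k => [|k [IH1 IH2]].
  by rewrite !expr0 mulr0n pcoef1 eqxx; split=> //; apply: pdle1.
by rewrite !exprS mulrS pcoefM_top // IH2; split=> //; apply: pdleM.
Qed.

Lemma pdeg_eq a f : f a != 0 -> pdle a f -> pdeg f = a.
Proof.
move=> fa0 fa; rewrite /pdeg; case: xgetP => [b _ [fb0 fb]|/(_ a)[]//].
have [ab|ba|//] := ltgtP b a.
  by move: fa0; rewrite fb ?eqxx.
by move: fb0; rewrite fa ?eqxx.
Qed.

(** The support is bounded above and discrete, so it has a largest element. *)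
Lemma pdegP f : f != 0 -> f (pdeg f) != 0 /\ pdle (pdeg f) f.
Proof.
move=> f0.
suff [a [fa0 fa]] : exists a, f a != 0 /\ pdle a f by rewrite (pdeg_eq fa0 fa).
have [l [N [s [t [l0 Ef _]]]]] := pser_repr2 (pcoefP f) (pcoefP f).
have l0' : 0 < l%:R :> rat by rewrite ltr0n.
have exs : exists i, s i != 0.
  apply: contrapT => H; case/eqP: f0; apply: puiseux_eqP => q.
  rewrite Ef pcoef0; have [[i ->]|//] := pserP N s q l0.
  rewrite pserE //; apply/eqP/negP => H'; apply: H; exists i; exact/negP.
case: (ex_minnP exs) => i si mini.
exists (N%:R - i%:R / l%:R); rewrite Ef pserE //; split=> // r ir.
rewrite Ef; have [[j E]|//] := pserP N s r l0.
rewrite E pserE //; apply/eqP/negP => /negP/mini ij.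
move: ir; rewrite E ltrD2l ltrN2 ltr_pM2r ?invr_gt0 // ltr_nat; lia.
Qed.

Lemma pdeg_le a f : f != 0 -> pdle a f -> pdeg f <= a.
Proof. by move=> /pdegP[fa _] H; rewrite leNgt; apply: contra fa => /H ->. Qed.

End PuiseuxCoefficients.

(** * Coefficientwise operations *)

Section Coefficientwise.
Variables R S : comNzRingType.

Lemma pmapc_supp (h : rat -> R -> S) (h0 : forall q, h q 0 = 0) (f : puiseux R) :
  puiseux_supp (fun q => h q (f q)).
Proof.
case: (pcoefP f) => l [N [l0 H]]; exists l, N; split=> // q hq.
by apply: H; apply: contraNneq hq => ->; rewrite h0.
Qed.

Definition pmapc (h : rat -> R -> S) (h0 : forall q, h q 0 = 0) (f : puiseux R) :
  puiseux S := Puiseux (pmapc_supp h0 f).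

End Coefficientwise.

Section CoefficientwiseDerivation.
Variables (R : comNzRingType) (h : rat -> R -> R).
Hypothesis h0 : forall q, h q 0 = 0.
Hypothesis hD : forall q a b, h q (a + b) = h q a + h q b.
Hypothesis hM : forall p q a b, h (p + q) (a * b) = h p a * b + a * h q b.

(** The graded Leibniz rule covers both the Euler derivation x d/dx, where
    [h q] is multiplication by [q], and the derivation with respect to a
    variable of the coefficient ring, where [h q] does not depend on [q]. *)
Lemma pmapc_leibniz (f g : puiseux R) :
  pmapc h0 (f * g) = pmapc h0 f * g + f * pmapc h0 g.
Proof.
apply: puiseux_eqP => q; have [A HA] := pcoefM_finite f g q.
rewrite pcoefD -[LHS]/(h q ((f * g) q)) (pcoefM_fset HA).
have H1 p : p \notin A -> pmapc h0 f p = 0 \/ g (q - p) = 0.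
  by move=> /HA[fp|->]; [left; rewrite /= fp h0|right].
have H2 p : p \notin A -> f p = 0 \/ pmapc h0 g (q - p) = 0.
  by move=> /HA[->|gp]; [left|right; rewrite /= gp h0].
rewrite (pcoefM_fset H1) (pcoefM_fset H2).
rewrite -big_split /= (big_morph (h q) (hD q) (h0 q)).
by apply: eq_bigr => p _; rewrite -hM [p + _]addrC subrK.
Qed.

End CoefficientwiseDerivation.


(** * Puiseux series over a domain *)

Section PuiseuxDomain.
Variable R : idomainType.
Implicit Types f g : puiseux R.

Lemma pmul_neq0 f g : f != 0 -> g != 0 -> (f * g) (pdeg f + pdeg g) != 0.
Proof.
by move=> /pdegP[f0 fd] /pdegP[g0 gd]; rewrite pcoefM_top // mulf_neq0.
Qed.

(** Invertible series are singled out classically; the integral domain structure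
    is built on this notion of unit. *)
Definition punit : pred (puiseux R) := fun f => `[< exists g, g * f = 1 >].

Definition pinv f : puiseux R :=
  if pselect (exists g, g * f = 1) is left h then projT1 (cid h) else f.

Lemma pmulV : {in punit, left_inverse 1 pinv *%R}.
Proof. by move=> f /asboolP fu; rewrite /pinv; case: pselect => // h; case: cid. Qed.

Lemma punitP f g : g * f = 1 -> punit f.
Proof. by move=> gf; apply/asboolP; exists g. Qed.

Lemma pinv_out : {in [predC punit], pinv =1 id}.
Proof. by move=> f; rewrite inE /= /pinv => /asboolP fu; case: pselect. Qed.

HB.instance Definition _ :=
  GRing.ComNzRing_hasMulInverse.Build (puiseux R) pmulV punitP pinv_out.

Lemma pmulf_eq0 f g : f * g = 0 -> (f == 0) || (g == 0).
Proof.
apply: contra_eqT; rewrite negb_or => /andP[f0 g0].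
by apply: contraTneq (pmul_neq0 f0 g0) => ->; rewrite pcoef0 eqxx.
Qed.

HB.instance Definition _ := GRing.ComUnitRing_isIntegral.Build (puiseux R) pmulf_eq0.

Lemma pdegM f g : f != 0 -> g != 0 -> pdeg (f * g) = pdeg f + pdeg g.
Proof.
move=> f0 g0; apply: pdeg_eq; first exact: pmul_neq0.
by have [[_ ?] [_ ?]] := (pdegP f0, pdegP g0); apply: pdleM.
Qed.

Lemma pdeg_mono q (c : R) : c != 0 -> pdeg (pmono q c) = q.
Proof. by move=> c0; apply: pdeg_eq; [rewrite pcoefE eqxx|apply: pdle_mono]. Qed.

Lemma pmono_neq0 q (c : R) : c != 0 -> pmono q c != 0.
Proof.
by move=> c0; apply: contraNneq c0 => /(congr1 (fun f : puiseux R => f q)); rewrite pcoefE eqxx pcoef0 => ->.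
Qed.

Lemma pdeg1 : pdeg (1 : puiseux R) = 0.
Proof. exact/pdeg_mono/oner_neq0. Qed.

Lemma pdeg_prod (I : eqType) (s : seq I) (F : I -> puiseux R) :
  (forall i, i \in s -> F i != 0) ->
  pdeg (\prod_(i <- s) F i) = \sum_(i <- s) pdeg (F i).
Proof.
elim: s => [|i s IH] H; first by rewrite !big_nil pdeg1.
rewrite !big_cons pdegM ?IH ?H ?mem_head // => [j js|].
  by rewrite H // inE js orbT.
by rewrite prodf_seq_neq0; apply/allP => j js /=; rewrite H // inE js orbT.
Qed.

End PuiseuxDomain.

(** * Polynomials as series *)

Section PolynomialsAsSeries.
Variable R : comNzRingType.
Implicit Types p : {poly R}.

Lemma pcoef_pofpoly p q :
  pofpoly p q = if q \is a Num.nat then p`_(Num.truncn q) else 0.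
Proof.
rewrite /pofpoly pcoef_sum; case: ifPn => [/natrP[k ->]|nq].
  rewrite natrK; have [kp|pk] := ltnP k (size p).
    rewrite (bigD1 (Ordinal kp)) //= eqxx big1 ?addr0 // => i ik.
    rewrite eqr_nat; case: eqP => // E; case/eqP: ik; exact/val_inj.
  rewrite nth_default // big1 // => i _; rewrite pcoefE eqr_nat.
  by case: eqP => // E; move: (leq_trans (ltn_ord i) pk); rewrite E ltnn.
rewrite big1 // => i _; rewrite pcoefE; case: eqP => // E.
by rewrite E natr_nat in nq.
Qed.

Lemma pofpoly_nat p k : pofpoly p k%:R = p`_k.
Proof. by rewrite pcoef_pofpoly natr_nat natrK. Qed.

Lemma pofpoly_sum k p : (size p <= k)%N -> pofpoly p = \sum_(i < k) pmono i%:R p`_i.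
Proof.
move=> pk; rewrite /pofpoly (big_ord_widen k (fun i : nat => pmono i%:R p`_i : puiseux R)) //.
rewrite big_mkcond; apply: eq_bigr => i _; case: ltnP => // /(nth_default 0) ->.
by rewrite pmono0.
Qed.

Lemma pofpoly_is_zmod_morphism : zmod_morphism (@pofpoly R).
Proof.
move=> p q; apply: puiseux_eqP => r; rewrite pcoefB !pcoef_pofpoly.
by case: ifP => _; rewrite ?subrr // coefB.
Qed.

HB.instance Definition _ := GRing.isZmodMorphism.Build {poly R} (puiseux R)
  (@pofpoly R) pofpoly_is_zmod_morphism.

Lemma pofpolyC (c : R) : pofpoly c%:P = pmono 0 c.
Proof.
by rewrite (pofpoly_sum (size_polyC_leq1 c)) big_ord1 coefC.
Qed.

Lemma pofpolyMX p : pofpoly (p * 'X) = pofpoly p * pmono 1 1.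
Proof.
rewrite (@pofpoly_sum (size p).+1); last first.
  by have [->|p0] := eqVneq p 0; rewrite ?mul0r ?size_poly0 // size_mulX.
rewrite big_ord_recl coefMX eqxx pmono0 add0r mulr_suml.
by apply: eq_bigr => i _; rewrite coefMX pmonoM mulr1 /= natr1.
Qed.

Lemma pofpoly_is_monoid_morphism : monoid_morphism (@pofpoly R).
Proof.
split=> [|p q]; first by rewrite -polyC1 pofpolyC.
elim/poly_ind: p => [|p c IH]; first by rewrite mul0r raddf0 mul0r.
have DE (u v : {poly R}) : pofpoly (u + v) = pofpoly u + pofpoly v by exact: raddfD.
rewrite mulrDl !DE mulrDl.
rewrite -mulrA (mulrC 'X) mulrA !pofpolyMX IH.
rewrite -(mulrA (pofpoly p)) (mulrC (pofpoly q)) (mulrA (pofpoly p)).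
congr (_ + _).
rewrite mul_polyC pofpolyC mulrC.
apply: puiseux_eqP => r.
rewrite pcoef_mulmono subr0.
by rewrite !pcoef_pofpoly coefZ mulrC; case: ifP; rewrite ?mul0r.
Qed.

HB.instance Definition _ := GRing.isMonoidMorphism.Build {poly R} (puiseux R)
  (@pofpoly R) pofpoly_is_monoid_morphism.

Lemma pofpoly_inj : injective (@pofpoly R).
Proof.
by move=> p q E; apply/polyP => i; rewrite -!pofpoly_nat E.
Qed.

Lemma pdeg_pofpoly p : p != 0 -> pdeg (pofpoly p) = (size p).-1%:R.
Proof.
move=> p0; apply: pdeg_eq; first by rewrite pofpoly_nat -lead_coefE lead_coef_eq0.
move=> r; rewrite pcoef_pofpoly; case: ifP => // /natrP[k ->].
rewrite ltr_nat natrK => pk; rewrite nth_default //.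
by move: pk; case: (size p).
Qed.

End PolynomialsAsSeries.


(** * Derivations *)

Section CharacteristicZero.
Variable K : fieldType.
Hypothesis charK : [pchar K] =i pred0.

Lemma natr_char0_eq0 k : (k%:R == 0 :> K) = (k == 0)%N.
Proof. exact: (pcharf0P K).1. Qed.

Lemma intr_char0_eq0 (z : int) : (z%:~R == 0 :> K) = (z == 0).
Proof.
case: z => k; first by rewrite -pmulrn natr_char0_eq0.
by rewrite NegzE mulrNz oppr_eq0 oppr_eq0 -pmulrn natr_char0_eq0.
Qed.

(** Any fraction computes [ratr], which gives its additivity over a field of
    characteristic 0 by clearing denominators. *)
Lemma ratr_char0_frac (x : rat) (y z : int) :
  z != 0 -> x * z%:~R = y%:~R -> ratr x * z%:~R = y%:~R :> K.
Proof.
move=> z0 E; rewrite /ratr.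
have d0 : (denq x)%:~R != 0 :> K by rewrite intr_char0_eq0 denq_neq0.
rewrite mulrAC; apply: (canLR (mulfK d0)); rewrite -!rmorphM /=; congr (_%:~R).
apply/eqP; rewrite -(eqr_int rat) !rmorphM /= -E numqE; apply/eqP; ring.
Qed.

Lemma ratr_char0D (x y : rat) : ratr (x + y) = ratr x + ratr y :> K.
Proof.
have dx0 : (denq x)%:~R != 0 :> K by rewrite intr_char0_eq0 denq_neq0.
have dy0 : (denq y)%:~R != 0 :> K by rewrite intr_char0_eq0 denq_neq0.
have d0 : denq x * denq y != 0 by rewrite mulf_neq0 // denq_neq0.
have d0' : (denq x * denq y)%:~R != 0 :> K by rewrite intr_char0_eq0.
have E : (x + y) * (denq x * denq y)%:~R = (numq x * denq y + numq y * denq x)%:~R.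
  by rewrite rmorphD !rmorphM /= !numqE; ring.
rewrite (canRL (mulfK d0') (ratr_char0_frac d0 E)).
by rewrite rmorphD !rmorphM /= /ratr; field; rewrite dx0 dy0.
Qed.

Lemma ratr_char0_eq0 (x : rat) : (ratr x == 0 :> K) = (x == 0).
Proof.
rewrite /ratr mulf_eq0 invr_eq0 !intr_char0_eq0.
by rewrite (negPf (denq_neq0 x)) orbF numq_eq0.
Qed.

End CharacteristicZero.

Section ChainRule.
Variables A L : comNzRingType.
Variables (phi : {rmorphism A -> L}) (E : A -> A) (D : L -> L).
Hypothesis E0 : E 0 = 0.
Hypothesis D0 : D 0 = 0.
Hypothesis DD : forall f g, D (f + g) = D f + D g.
Hypothesis DM : forall f g, D (f * g) = D f * g + f * D g.
Hypothesis Dphi : forall c, D (phi c) = phi (E c).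

(** The chain rule, for a derivation of the target that restricts to [E] on the
    coefficients. *)
Lemma derivation_horner (F : {poly A}) (s : L) :
  D (map_poly phi F).[s] =
    (map_poly phi (map_poly E F)).[s] + (map_poly phi F^`()).[s] * D s.
Proof.
have M0 : map_poly E 0 = 0 by apply/polyP => i; rewrite coef_map_id0 ?coef0.
elim/poly_ind: F => [|F c IH]; first by rewrite M0 deriv0 !rmorph0 horner0 mul0r addr0.
have -> : map_poly E (F * 'X + c%:P) = map_poly E F * 'X + (E c)%:P.
  apply/polyP => i; rewrite coef_map_id0 // !coefD !coefMX !coefC.
  by case: i => [|i] /=; rewrite ?add0r ?addr0 // coef_map_id0.
rewrite derivD derivC addr0 derivM derivX mulr1.
rewrite !(rmorphD, rmorphM, hornerE) /= !map_polyC !map_polyX !hornerE /=.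
rewrite DD DM IH Dphi; ring.
Qed.

End ChainRule.

Section Euler.
Variables (R : comNzRingType) (e : rat -> R).

(** The Euler derivation x d/dx, relative to an embedding [e] of the exponents. *)
Definition euler : puiseux R -> puiseux R :=
  pmapc (h := fun q a => e q * a) (fun q => mulr0 (e q)).

Lemma eulerE f q : euler f q = e q * f q.
Proof. by []. Qed.

Lemma euler_is_zmod_morphism : zmod_morphism euler.
Proof. by move=> f g; apply: puiseux_eqP => q; rewrite pcoefB !eulerE pcoefB mulrBr. Qed.

HB.instance Definition _ := GRing.isZmodMorphism.Build (puiseux R) (puiseux R)
  euler euler_is_zmod_morphism.

Lemma eulerM (eD : forall p q, e (p + q) = e p + e q) f g :
  euler (f * g) = euler f * g + f * euler g.
Proof.
apply: pmapc_leibniz => [q a b|p q a b]; first exact: mulrDr.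
by rewrite eD; ring.
Qed.

Lemma pdle_euler a f : pdle a f -> pdle a (euler f).
Proof. by move=> fa r /fa fr; rewrite eulerE fr mulr0. Qed.

End Euler.

Definition xderiv (R : comNzRingType) (c : {poly R}) : {poly R} := 'X * c^`().

Lemma xderiv_is_zmod_morphism (R : comNzRingType) : zmod_morphism (@xderiv R).
Proof. by move=> c d; rewrite /xderiv derivB mulrBr. Qed.

HB.instance Definition _ (R : comNzRingType) :=
  GRing.isZmodMorphism.Build {poly R} {poly R} (@xderiv R) (@xderiv_is_zmod_morphism R).

Lemma map_xderiv (K : fieldType) (F : {poly {poly K}}) :
  map_poly (@xderiv K) F = xvar K * dx F.
Proof.
by apply/polyP => i; rewrite mul_polyC coefZ !coef_map_id0 /xderiv ?raddf0 ?mulr0.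
Qed.

Section CoefficientVariable.
Variable R : comNzRingType.

Definition dpi : puiseux {poly R} -> puiseux {poly R} :=
  pmapc (h := fun _ => @deriv R) (fun _ => deriv0 R).

Lemma dpiE f q : dpi f q = (f q)^`().
Proof. by []. Qed.

Lemma dpi_is_zmod_morphism : zmod_morphism dpi.
Proof. by move=> f g; apply: puiseux_eqP => q; rewrite pcoefB !dpiE pcoefB derivB. Qed.

HB.instance Definition _ := GRing.isZmodMorphism.Build (puiseux {poly R}) (puiseux {poly R})
  dpi dpi_is_zmod_morphism.

Lemma dpiM f g : dpi (f * g) = dpi f * g + f * dpi g.
Proof.
by apply: pmapc_leibniz => [q a b|p q a b]; rewrite ?derivD // derivM.
Qed.

Lemma pdle_dpi a f : pdle a f -> pdle a (dpi f).
Proof. by move=> fa r /fa fr; rewrite dpiE fr deriv0. Qed.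

End CoefficientVariable.

Section Evaluation.
Variable K : closedFieldType.
Implicit Types (F G : {poly {poly K}}) (tau : pi_approx K).

Lemma pconstE (f : puiseux K) q : pconst f q = (f q)%:P.
Proof. by []. Qed.

Lemma pconst_is_zmod_morphism : zmod_morphism (@pconst K).
Proof. by move=> f g; apply: puiseux_eqP => q; rewrite pcoefB !pconstE pcoefB polyCB. Qed.

HB.instance Definition _ := GRing.isZmodMorphism.Build (puiseux K) (puiseux {poly K})
  (@pconst K) pconst_is_zmod_morphism.

Lemma pconst_is_monoid_morphism : monoid_morphism (@pconst K).
Proof.
split=> [|f g]; apply: puiseux_eqP => q; first by rewrite pconstE !pcoef1 polyC_natr.
have [A HA] := pcoefM_finite f g q.
rewrite pconstE (pcoefM_fset HA) (@pcoefM_fset _ A) => [|p /HA[] H]; last 2 first.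
- by left; rewrite pconstE H polyC0.
- by right; rewrite pconstE H polyC0.
by rewrite (big_morph _ (@polyCD K) (polyC0 K)); apply: eq_bigr => p _; rewrite polyCM.
Qed.

HB.instance Definition _ := GRing.isMonoidMorphism.Build (puiseux K) (puiseux {poly K})
  (@pconst K) pconst_is_monoid_morphism.

Lemma pconst_inj : injective (@pconst K).
Proof.
move=> f g E; apply: puiseux_eqP => q; apply: (@polyC_inj K).
by rewrite -!pconstE E.
Qed.

Definition ev F (alpha : puiseux K) : puiseux K := (map_poly (@pofpoly K) F).[alpha].

Lemma psubstE F tau : psubst F tau = (map_poly (@pconst K) (map_poly (@pofpoly K) F)).[pi_series tau].
Proof. by rewrite /psubst -map_poly_comp. Qed.

Lemma psubstE_phi F tau : psubst F tau = (map_poly (@pconst K \o @pofpoly K) F).[pi_series tau].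
Proof. by []. Qed.

(** Polynomials in y over series, read as series with coefficients in K[pi]. *)
Definition swap (H : {poly puiseux K}) : puiseux {poly K} :=
  (map_poly (@pconst K) H).[pmono 0 'X].

Lemma swapE (H : {poly puiseux K}) q k : (swap H q)`_k = H`_k q.
Proof.
suff -> : swap H q = \poly_(k < size H) H`_k q.
  by rewrite coef_poly; case: ltnP => // /(nth_default 0) ->; rewrite pcoef0.
rewrite /swap horner_coef (size_map_inj_poly pconst_inj) ?raddf0 // pcoef_sum poly_def.
apply: eq_bigr => i _; rewrite coef_map_id0 ?raddf0 //.
have -> : pmono 0 'X ^+ i = pmono 0 'X^i :> puiseux {poly K}.
  elim: (i : nat) => [|j IH]; first by rewrite !expr0.
  by rewrite !exprS IH pmonoM addr0.
by rewrite pcoef_mulmono subr0 pconstE mul_polyC.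
Qed.

Lemma swapM (G H : {poly puiseux K}) : swap (G * H) = swap G * swap H.
Proof. by rewrite /swap rmorphM hornerM. Qed.

Definition agrees (gamma : puiseux K) tau := forall j : rat, tau.2 < j -> gamma j = tau.1 j.

(** Substituting y = tau + pi x^j and then reading off the coefficient at x^q
    commutes with specialising pi, at the top level only: a series agreeing with
    tau above x^j is obtained by giving pi a value of degree at most 0, and only
    its constant term contributes. *)
Lemma ev_top G tau gamma q : (forall j : rat, j <= tau.2 -> tau.1 j = 0) ->
  agrees gamma tau -> pdle q (psubst G tau) ->
  pdle q (ev G gamma) /\ ev G gamma q = (psubst G tau q).[gamma tau.2].
Proof.
move=> trunc agr; set j := tau.2.
pose u := (gamma - tau.1) * pmono (- j) 1.
have gE : gamma = tau.1 + pmono j 1 * u.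
  rewrite /u mulrCA pmonoM subrr mulr1 -[pmono 0 1]/(1 : puiseux K) mulr1; ring.
have u0 : pdle 0 u.
  move=> r r0; rewrite /u pcoef_mulmono opprK mulr1 pcoefB agr ?subrr //; rewrite /j; lra.
have uE : u 0 = gamma j.
  by rewrite /u pcoef_mulmono opprK add0r mulr1 pcoefB trunc ?subr0.
clearbody u.
(* [H] is G with y replaced by tau + x^j Y: its value at [u] is G(gamma), and
   its value at pi is G(tau). *)
pose H := map_poly (@pofpoly K) G \Po (tau.1%:P + (pmono j 1)%:P * 'X).
have evE : ev G gamma = H.[u].
  by rewrite horner_comp !hornerE -gE.
have -> : psubst G tau = (map_poly (@pconst K) H).[pmono 0 'X].
  rewrite map_comp_poly horner_comp psubstE; congr _.[_].
  rewrite rmorphD rmorphM /= !map_polyC map_polyX !hornerE /pi_series; congr (_ + _).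
  apply: puiseux_eqP => r; rewrite pcoef_mulmono subr0 pconstE !pcoefE.
  by case: ifP => _; rewrite ?polyC1 ?mul1r // polyC0 mul0r.
rewrite -/(swap H) => Hq; have Hk k : pdle q H`_k.
  by move=> r /Hq E; rewrite -swapE E coef0.
have sE : swap H q = \poly_(k < size H) H`_k q.
  apply/polyP => k; rewrite swapE coef_poly; case: ltnP => // /(nth_default 0) ->.
  exact: pcoef0.
rewrite evE horner_coef sE horner_poly.
have Hu k : pdle q (H`_k * u ^+ k) /\ (H`_k * u ^+ k) q = H`_k q * gamma j ^+ k.
  have [] := pdleX k u0; rewrite mul0rn => uk uk0.
  split; first by have := pdleM (Hk k) uk; rewrite addr0.
  by have := pcoefM_top (Hk k) uk; rewrite addr0 uk0 uE.
split; first by apply: pdle_sum => i _; exact: (Hu i).1.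
by rewrite pcoef_sum; apply: eq_bigr => i _; rewrite (Hu i).2.
Qed.

End Evaluation.


(** * Levels of a substitution along a pi-approximation *)

Section Levels.
Variable K : closedFieldType.
Implicit Types (F G : {poly {poly K}}) (tau : pi_approx K) (rs : seq (puiseux K)).
Implicit Types (gamma beta : puiseux K) (j : rat).

Definition truncated tau := forall j : rat, j <= tau.2 -> tau.1 j = 0.

Definition approx gamma j : pi_approx K :=
  (pmapc (h := fun q a => if j < q then a else 0) (fun q => if_same _ 0) gamma, j).

Lemma approx_truncated gamma j : truncated (approx gamma j).
Proof. by move=> i /= ij; rewrite ltNge ij. Qed.

Lemma agrees_approx gamma j : agrees gamma (approx gamma j).
Proof. by move=> i /= ->. Qed.

Lemma approxE tau gamma : truncated tau -> agrees gamma tau -> tau = approx gamma tau.2.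
Proof.
case: tau => A j tr ag; congr pair; apply: puiseux_eqP => q /=.
by case: ltP => [/ag //|/tr].
Qed.

Lemma mem_Dtau rs tau beta : (beta \in Dtau rs tau) = `[< agrees beta tau >] && (beta \in rs).
Proof. by rewrite mem_filter. Qed.

(** The order of [beta - (gamma + pi x^j)] for generic pi. *)
Definition lev gamma j beta : rat :=
  if gamma == beta then j else Num.max j (pdeg (gamma - beta)).

Definition Lev gamma j rs : rat := \sum_(beta <- rs) lev gamma j beta.

Lemma lev_le gamma i j beta : i <= j -> lev gamma i beta <= lev gamma j beta.
Proof. by move=> ij; rewrite /lev; case: eqP => // _; rewrite ge_max !le_max ij lexx orbT. Qed.

(** Agreement above x^j is an ultrametric ball, so any of its members can serve as
    centre. *)
Lemma agreesE gamma tau beta : agrees gamma tau ->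
  agrees beta tau <-> gamma = beta \/ pdeg (gamma - beta) <= tau.2.
Proof.
move=> ag; split=> [bt|[<- //|]].
  have [->|ne] := eqVneq gamma beta; [by left|right].
  apply: pdeg_le; first by rewrite subr_eq0.
  by move=> r jr; rewrite pcoefB ag // bt // subrr.
have [<- //|ne] := eqVneq gamma beta.
rewrite -subr_eq0 in ne; have [_ H] := pdegP ne => le i ji.
apply/eqP; rewrite -ag // eq_sym -subr_eq0 -pcoefB H //; exact: le_lt_trans ji.
Qed.

Lemma lev_agrees gamma tau beta : agrees gamma tau -> agrees beta tau ->
  lev gamma tau.2 beta = tau.2.
Proof.
move=> ag /(agreesE _ ag) [->|]; rewrite /lev ?eqxx // => le.
by case: eqP => // _; apply/max_idPl.
Qed.

Lemma lev_not_agrees gamma tau beta : agrees gamma tau -> ~ agrees beta tau ->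
  [/\ gamma != beta, tau.2 < pdeg (gamma - beta) & lev gamma tau.2 beta = pdeg (gamma - beta)].
Proof.
move=> ag nb; have ne : gamma != beta.
  by apply/eqP => E; apply: nb; apply/(agreesE _ ag); left.
have lt : tau.2 < pdeg (gamma - beta).
  by rewrite ltNge; apply/negP => le; apply: nb; apply/(agreesE _ ag); right.
by split=> //; rewrite /lev (negPf ne); apply/max_idPr/ltW.
Qed.

(** A root in the ball keeps the variable pi at top level; any other root differs
    from tau at a higher exponent, where pi does not occur. *)
Lemma pi_factor_top tau gamma beta : truncated tau -> agrees gamma tau ->
  let e := lev gamma tau.2 beta in
  pdle e (pi_series tau - pconst beta) /\
  if `[< agrees beta tau >] then (pi_series tau - pconst beta) e = 'X - (beta tau.2)%:P
  else exists2 c, c != 0 & (pi_series tau - pconst beta) e = c%:P.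
Proof.
move=> tr ag e.
have cE q : (pi_series tau - pconst beta) q =
    (tau.1 q - beta q)%:P + (if q == tau.2 then 'X else 0).
  by rewrite pcoefB /pi_series pcoefD !pconstE pcoefE polyCB addrAC.
case: asboolP => bt; rewrite /e.
  rewrite lev_agrees //; split=> [r jr|].
    by rewrite cE bt // subrr gt_eqF // polyC0 addr0.
  by rewrite cE eqxx tr // sub0r polyCN addrC.
have [ne lt ->] := lev_not_agrees ag bt.
rewrite -subr_eq0 in ne; have [n0 H] := pdegP ne.
split=> [r er|].
  have jr : tau.2 < r by apply: lt_trans er.
  by rewrite cE gt_eqF // addr0 -ag // -pcoefB H.
exists ((gamma - beta) (pdeg (gamma - beta))) => //.
by rewrite cE gt_eqF // addr0 -ag.
Qed.

Definition has_roots F rs := map_poly (@pofpoly K) F = \prod_(alpha <- rs) ('X - alpha%:P).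

Lemma psubst_prod F rs tau : has_roots F rs ->
  psubst F tau = \prod_(alpha <- rs) (pi_series tau - pconst alpha).
Proof.
move=> FE; rewrite psubstE FE rmorph_prod horner_prod; apply: eq_bigr => alpha _.
by rewrite rmorphB /= map_polyX map_polyC /= !hornerE.
Qed.

Lemma ev_prod F rs gamma : has_roots F rs -> ev F gamma = \prod_(alpha <- rs) (gamma - alpha).
Proof.
by move=> FE; rewrite /ev FE horner_prod; apply: eq_bigr => alpha _; rewrite !hornerE.
Qed.

Lemma psubst_top F rs tau gamma : has_roots F rs -> truncated tau -> agrees gamma tau ->
  pdle (Lev gamma tau.2 rs) (psubst F tau) /\
  exists2 c, c != 0 & psubst F tau (Lev gamma tau.2 rs) =
     c%:P * \prod_(beta <- Dtau rs tau) ('X - (beta tau.2)%:P).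
Proof.
move=> FE tr ag; rewrite (psubst_prod _ FE).
have [] := pdle_prod rs (fun beta => (pi_factor_top beta tr ag).1).
rewrite -/(Lev _ _ _) => H1 ->; split=> // {H1}.
elim: rs {FE} => [|beta rs [c c0 IH]].
  by exists 1; rewrite ?oner_neq0 // !big_nil mulr1.
have DE : Dtau (beta :: rs) tau =
  if `[< agrees beta tau >] then beta :: Dtau rs tau else Dtau rs tau by [].
rewrite big_cons DE {}IH {DE}.
have [_] := pi_factor_top beta tr ag; case: asboolP => bt => [->|[d d0 ->]].
  by exists c => //; rewrite big_cons; ring.
by exists (d * c); rewrite ?mulf_neq0 // polyCM; ring.
Qed.

Lemma prod_XsubC_neq0 (I : Type) (s : seq I) (F : I -> K) :
  \prod_(i <- s) ('X - (F i)%:P) != 0.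
Proof. by rewrite monic_neq0 // monic_prod_XsubC. Qed.

Lemma lambdaE F rs tau gamma : has_roots F rs -> truncated tau -> agrees gamma tau ->
  lambda F tau = Lev gamma tau.2 rs.
Proof.
move=> FE tr ag; have [le [c c0 E]] := psubst_top FE tr ag.
by apply: pdeg_eq; rewrite // E mulf_neq0 ?polyC_eq0 ?prod_XsubC_neq0.
Qed.

Lemma fpolyP F rs tau : has_roots F rs -> truncated tau ->
  pdle (lambda F tau) (psubst F tau) /\
  exists2 c, c != 0 & fpoly F tau = c%:P * \prod_(beta <- Dtau rs tau) ('X - (beta tau.2)%:P).
Proof.
move=> FE tr; have ag : agrees tau.1 tau by [].
have [] := psubst_top FE tr ag.
by rewrite /fpoly (lambdaE FE tr ag).
Qed.

Lemma fpoly_neq0 F rs tau : has_roots F rs -> truncated tau -> fpoly F tau != 0.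
Proof.
move=> FE tr; have [_ [c c0 ->]] := fpolyP FE tr.
by rewrite mulf_neq0 ?polyC_eq0 ?prod_XsubC_neq0.
Qed.

Lemma size_fpoly F rs tau : has_roots F rs -> truncated tau ->
  size (fpoly F tau) = (size (Dtau rs tau)).+1.
Proof.
move=> FE tr; have [_ [c c0 ->]] := fpolyP FE tr.
by rewrite mul_polyC size_scale // size_prod_XsubC.
Qed.

Lemma root_fpoly F rs tau alpha : has_roots F rs -> truncated tau ->
  alpha \in Dtau rs tau -> root (fpoly F tau) (alpha tau.2).
Proof.
move=> FE tr aD; have [_ [c c0 ->]] := fpolyP FE tr.
by apply/rootP; rewrite hornerM horner_prod (big_rem _ aD) /= hornerXsubC subrr mul0r mulr0.
Qed.

(** A single root in the ball makes the level strictly increasing. *)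
Lemma Lev_lt gamma i j rs : i < j ->
  (exists2 beta, beta \in rs & agrees beta (approx gamma i)) ->
  Lev gamma i rs < Lev gamma j rs.
Proof.
move=> ij [beta brs bt]; rewrite /Lev !(big_rem _ brs) /=.
apply: ltr_leD; last by apply: ler_sum => ? _; apply/lev_le/ltW.
rewrite (lev_agrees (tau := approx gamma i) (@agrees_approx _ _) bt) /lev /=.
by case: eqP => // _; rewrite lt_max ij.
Qed.

End Levels.

(** * The Jacobian condition along a pi-approximation *)

Section Bracket.
Variable K : closedFieldType.
Hypothesis charK : [pchar K] =i pred0.
Implicit Types (F G : {poly {poly K}}) (tau : pi_approx K).
Implicit Types (alpha beta : puiseux K) (c : K).

Let eP (q : rat) : {poly K} := (ratr q)%:P.

Lemma eP_D p q : eP (p + q) = eP p + eP q.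
Proof. by rewrite /eP ratr_char0D // polyCD. Qed.

Lemma euler_pofpoly (c : {poly K}) :
  euler (@ratr K) (pofpoly c) = pofpoly (xderiv c).
Proof.
apply: puiseux_eqP => q; rewrite eulerE !pcoef_pofpoly; case: ifP; last by rewrite mulr0.
move=> /natrP[k ->]; rewrite natrK /xderiv coefXM coef_deriv ratr_nat.
by case: k => [|k] /=; rewrite ?mul0r // mulr_natl.
Qed.

Lemma euler_pconst (f : puiseux K) : euler eP (pconst f) = pconst (euler (@ratr K) f).
Proof. by apply: puiseux_eqP => q; rewrite eulerE !pconstE eulerE polyCM. Qed.

Lemma dpi_pconst (f : puiseux K) : dpi (pconst f) = 0.
Proof. by apply: puiseux_eqP => q; rewrite dpiE pconstE derivC pcoef0. Qed.

Lemma dpi_pi_series tau : dpi (pi_series tau) = pmono tau.2 1.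
Proof.
rewrite /pi_series raddfD /= dpi_pconst add0r; apply: puiseux_eqP => q.
by rewrite dpiE !pcoefE; case: ifP; rewrite ?derivX ?deriv0.
Qed.

Lemma dpi_psubst F tau : dpi (psubst F tau) = psubst (dy F) tau * pmono tau.2 1.
Proof.
rewrite psubstE_phi (@derivation_horner _ _ _ (fun _ => 0) (@dpi K)) //.
- rewrite dpi_pi_series [map_poly _ F](_ : _ = 0) ?rmorph0 ?horner0 ?add0r //.
  by apply/polyP => i; rewrite coef_map_id0 ?coef0.
- exact: raddf0.
- exact: raddfD.
- exact: dpiM.
- by move=> d; rewrite rmorph0; apply: dpi_pconst.
Qed.

Lemma euler_psubst F tau : euler eP (psubst F tau) =
  psubst (xvar K * dx F) tau + psubst (dy F) tau * euler eP (pi_series tau).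
Proof.
rewrite psubstE_phi (@derivation_horner _ _ _ (@xderiv K) (euler eP)) ?map_xderiv //.
- exact: raddf0.
- exact: raddf0.
- exact: raddfD.
- exact: (eulerM eP_D).
- by move=> d; rewrite /= euler_pconst euler_pofpoly.
Qed.

Lemma euler_ev F alpha : euler (@ratr K) (ev F alpha) =
  ev (xvar K * dx F) alpha + ev (dy F) alpha * euler (@ratr K) alpha.
Proof.
rewrite /ev (@derivation_horner _ _ _ (@xderiv K) (euler (@ratr K))) ?map_xderiv //.
- exact: raddf0.
- exact: raddf0.
- exact: raddfD.
- exact: (eulerM (ratr_char0D charK)).
- exact: euler_pofpoly.
Qed.

Lemma evM F G alpha : ev (F * G) alpha = ev F alpha * ev G alpha.
Proof. by rewrite /ev rmorphM hornerM. Qed.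

Lemma evB F G alpha : ev (F - G) alpha = ev F alpha - ev G alpha.
Proof. by rewrite /ev rmorphB hornerD hornerN. Qed.

Lemma ev_xvar alpha : ev (xvar K) alpha = pmono 1 1.
Proof. by rewrite /ev map_polyC hornerC /= -['X]mul1r pofpolyMX rmorph1 mul1r. Qed.

Lemma evC c alpha : ev c%:P%:P alpha = pmono 0 c.
Proof. by rewrite /ev map_polyC hornerC /= pofpolyC. Qed.

Lemma psubstM F G tau : psubst (F * G) tau = psubst F tau * psubst G tau.
Proof. by rewrite !psubstE_phi rmorphM hornerM. Qed.

Lemma psubstB F G tau : psubst (F - G) tau = psubst F tau - psubst G tau.
Proof. by rewrite !psubstE_phi rmorphB hornerD hornerN. Qed.

Lemma psubst_xvar tau : psubst (xvar K) tau = pmono 1 1.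
Proof.
rewrite psubstE_phi map_polyC hornerC /= -['X]mul1r pofpolyMX rmorph1 mul1r.
by apply: puiseux_eqP => q; rewrite pconstE !pcoefE; case: ifP.
Qed.

Lemma psubstC c tau : psubst c%:P%:P tau = pmono 0 c%:P.
Proof.
rewrite psubstE_phi map_polyC hornerC /= pofpolyC.
by apply: puiseux_eqP => q; rewrite pconstE !pcoefE; case: ifP.
Qed.

Variables (F G : {poly {poly K}}) (c : K).
Hypothesis jacFG : jac F G = c%:P%:P.

(** The Jacobian of (F, G) in the coordinates (x, pi), compared at top level. *)
Lemma bracket_top tau p q : pdle p (psubst F tau) -> pdle q (psubst G tau) ->
  let f := psubst F tau p in let g := psubst G tau q in
  exists k : K, (ratr p)%:P * f * g^`() - (ratr q)%:P * f^`() * g = k%:P.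
Proof.
move=> Fp Gq f g; set j := tau.2.
have E : euler eP (psubst F tau) * dpi (psubst G tau)
       - dpi (psubst F tau) * euler eP (psubst G tau) = pmono (1 + j) c%:P.
  have /(congr1 (fun H => psubst H tau)) := jacFG.
  rewrite /jac psubstB !psubstM psubstC => J.
  rewrite !dpi_psubst !euler_psubst !psubstM psubst_xvar.
  have -> : pmono (1 + j) c%:P = pmono 1 1 * pmono j 1 * pmono 0 c%:P.
    by rewrite !pmonoM addr0 !mul1r.
  rewrite -J /j; ring.
have /(congr1 (fun h : puiseux {poly K} => h (p + q))) := E.
rewrite pcoefB (pcoefM_top (pdle_euler _ Fp) (pdle_dpi Gq)).
rewrite (pcoefM_top (pdle_dpi Fp) (pdle_euler _ Gq)) !eulerE !dpiE -/f -/g pcoefE => H.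
exists (if p + q == 1 + j then c else 0).
rewrite -[(ratr p)%:P]/(eP p) -[(ratr q)%:P]/(eP q).
have -> : eP q * f^`() * g = f^`() * (eP q * g) by rewrite mulrCA mulrA.
by rewrite H; case: ifP.
Qed.

(** The derivatives of F(alpha) = 0 and of G(alpha) along x eliminate theta(alpha). *)
Lemma jac_ev alpha : ev F alpha = 0 ->
  ev (dy F) alpha * euler (@ratr K) (ev G alpha) = - pmono 1 c.
Proof.
move=> F0; have /(congr1 (fun H => ev H alpha)) := jacFG.
rewrite /jac evB !evM evC => J.
have := euler_ev F alpha; rewrite F0 raddf0 evM ev_xvar => D.
rewrite euler_ev evM ev_xvar.
have -> : pmono 1 c = pmono 1 1 * pmono 0 c by rewrite pmonoM addr0 mul1r.
rewrite -J mulrDr; set u := ev (dy F) alpha in D *; set t := euler _ _ in D *.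
have -> : u * (ev (dy G) alpha * t) = ev (dy G) alpha * (u * t) by ring.
have -> : u * t = - (pmono 1 1 * ev (dx F) alpha) by rewrite -[RHS]addr0 D; ring.
ring.
Qed.

Lemma jac_ev_dy beta : ev (dy F) beta = 0 ->
  euler (@ratr K) (ev F beta) = pmono 1 1 * ev (dx F) beta /\
  ev (dx F) beta * ev (dy G) beta = pmono 0 c.
Proof.
move=> F0; have /(congr1 (fun H => ev H beta)) := jacFG.
rewrite /jac evB !evM evC F0 mulr0 subr0 => ->; split=> //.
by rewrite euler_ev F0 mul0r addr0 evM ev_xvar.
Qed.

End Bracket.


(** * The Newton-Puiseux theorem *)

Section CourseOfValues.
Variables (T : Type) (Phi : seq T -> T).

Fixpoint prefix_seq j : seq T :=
  if j is i.+1 then rcons (prefix_seq i) (Phi (prefix_seq i)) else [::].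

Lemma course_of_values : exists s : nat -> T, forall j, s j = Phi (mkseq s j).
Proof.
exists (fun j => Phi (prefix_seq j)) => j; congr Phi.
by elim: j => // j IH; rewrite mkseqS -IH.
Qed.

End CourseOfValues.

Section Hensel.
Variable K : fieldType.
Implicit Types g h r : {poly K}.

(** Bezout, with the first cofactor reduced modulo [g]; the bound on the second
    one follows by comparing degrees. *)
Lemma coprime_diophantine g h r : g \is monic -> h \is monic -> coprimep g h ->
  exists ab : {poly K} * {poly K}, [/\ ab.1 * h + g * ab.2 = r, (size ab.1 < size g)%N &
    (size r <= (size g).-1 + (size h).-1)%N -> (size ab.2 < size h)%N].
Proof.
move=> gm hm /Bezout_coprimepP[[u v] /= E].
have [c c0 {}E] : exists2 c, c != 0 & u * g + v * h = c%:P.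
  apply/size_poly1P; move/eqp_size: E; rewrite size_poly1 => ->; exact: eqxx.
pose w := c^-1 *: (r * v).
have Er : r = c^-1 *: (r * u) * g + w * h.
  rewrite /w -!scalerAl -!mulrA -scalerDr -mulrDr E mulrC mul_polyC scalerA.
  by rewrite mulVf ?scale1r.
have g0 := monic_neq0 gm; have h0 := monic_neq0 hm.
have E2 : w %% g * h + g * (c^-1 *: (r * u) + w %/ g * h) = r.
  rewrite [RHS]Er {3}(divp_eq w g); ring.
exists (w %% g, c^-1 *: (r * u) + w %/ g * h); split=> //=; first by rewrite ltn_modp.
set b := c^-1 *: (r * u) + w %/ g * h in E2 *; set a := w %% g in E2.
have sa : (size a < size g)%N by rewrite ltn_modp.
have sg : (0 < size g)%N by rewrite size_poly_gt0.
have sh : (0 < size h)%N by rewrite size_poly_gt0.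
move=> sr; have [->|b0] := eqVneq b 0; first by rewrite size_poly0.
have gb : size (g * b) = (size g + size b).-1 by rewrite size_mul.
have : (size (g * b)%R <= (size g).-1 + (size h).-1)%N.
  have -> : g * b = r - a * h by rewrite -E2; ring.
  rewrite (leq_trans (size_polyD _ _)) // geq_max sr size_polyN.
  by rewrite (leq_trans (size_polyMleq _ _)) //; move: sa sg sh; move: (size a) (size g) (size h) => i j k; lia.
rewrite gb; move: sg sh; move: (size b) (size g) (size h) => i j k; lia.
Qed.

(** Lifting a coprime factorisation one power of the uniformiser at a time. *)
Lemma hensel_series (F : nat -> {poly K}) g h :
  g \is monic -> h \is monic -> coprimep g h -> F 0 = g * h ->
  (forall j, (0 < j)%N -> (size (F j) <= (size g).-1 + (size h).-1)%N) ->
  exists G H : nat -> {poly K},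
    [/\ G 0 = g, H 0 = h, forall j, (0 < j)%N -> (size (G j) < size g)%N /\ (size (H j) < size h)%N &
        forall j, F j = \sum_(i < j.+1) G i * H (j - i)%N].
Proof.
move=> gm hm cop F0 sF.
pose sol r := projT1 (cid (coprime_diophantine r gm hm cop)).
have solP r : let ab := sol r in [/\ ab.1 * h + g * ab.2 = r, (size ab.1 < size g)%N &
    (size r <= (size g).-1 + (size h).-1)%N -> (size ab.2 < size h)%N].
  by rewrite /sol; case: cid.
pose z : {poly K} * {poly K} := (0, 0).
pose rhs (s : seq ({poly K} * {poly K})) :=
  F (size s) - \sum_(i < (size s).-1) (nth z s i.+1).1 * (nth z s (size s - i.+1)).2.
have [s sE] := course_of_values (fun s => if s is [::] then (g, h) else sol (rhs s)).
have s0 : s 0 = (g, h) by rewrite sE.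
have sS j : s j.+1 = sol (F j.+1 - \sum_(i < j) (s i.+1).1 * (s (j - i)%N).2).
  rewrite sE; set t := mkseq s j.+1.
  have -> : (if t is [::] then (g, h) else sol (rhs t)) = sol (rhs t) by [].
  congr sol; rewrite /rhs size_mkseq; congr (_ - _).
  by apply: eq_bigr => i _; rewrite subSS !nth_mkseq ?ltnS ?leq_subr ?ltn_ord.
have szs j : (0 < j)%N -> (size (s j).1 < size g)%N /\ (size (s j).2 < size h)%N.
  have sg : (0 < size g)%N by rewrite size_poly_gt0 monic_neq0.
  have sh : (0 < size h)%N by rewrite size_poly_gt0 monic_neq0.
  elim/ltn_ind: j => -[//|j] IH _; rewrite sS; set r := _ - _.
  have [_ s1 s2] := solP r; split=> //; apply: s2.
  rewrite (leq_trans (size_polyD _ _)) // geq_max sF //= size_polyN.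
  apply: (leq_trans (size_sum _ _ _)); apply/bigmax_leqP => i _.
  apply: (leq_trans (size_polyMleq _ _)).
  have [|//|a1 _] := IH i.+1; first by rewrite ltnS.
  have [||_ a2] := IH (j - i)%N; [by rewrite ltnS leq_subr|by rewrite subn_gt0 ltn_ord|].
  move: a1 a2 sg sh; set A := size (s i.+1).1; set B := size (s (j - i)%N).2.
  move: A B (size g) (size h) => A B C D; lia.
exists (fun j => (s j).1), (fun j => (s j).2); rewrite s0; split=> // -[|j].
  by rewrite big_ord1 s0 F0.
rewrite big_ord_recl big_ord_recr /= subn0 subnn s0 /=.
have [E _ _] := solP (F j.+1 - \sum_(i < j) (s i.+1).1 * (s (j - i)%N).2).
rewrite -sS in E.
rewrite (eq_bigr (fun i : 'I_j => (s i.+1).1 * (s (j - i)%N).2)) => [|i _]; last first.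
  by rewrite /bump /= subSS.
set S := \sum_(i < j) _ in E *.
rewrite -[LHS](subrK S) -E; ring.
Qed.

End Hensel.

Section Swap.
Variable K : closedFieldType.
Implicit Types (H : {poly puiseux K}) (f : puiseux {poly K}).

Definition unswap k f : {poly puiseux K} :=
  \poly_(i < k) pmapc (h := fun _ (p : {poly K}) => p`_i) (fun _ => coef0 K i) f.

(** Uniformly bounded degrees are what makes a series of polynomials a polynomial
    over series. *)
Lemma swap_unswap k f : (forall q, (size (f q) <= k)%N) -> swap (unswap k f) = f.
Proof.
move=> sf; apply: puiseux_eqP => q; apply/polyP => i; rewrite swapE coef_poly.
case: ltnP => [//|ki]; rewrite pcoef0 nth_default //; exact: leq_trans ki.
Qed.

Lemma swap_inj : injective (@swap K).
Proof.
move=> G H E; apply/polyP => i; apply: puiseux_eqP => q.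
by rewrite -!swapE E.
Qed.

Lemma pser0_repr (R : comNzRingType) (f : puiseux R) : pdle 0 f ->
  exists l, (0 < l)%N /\ pcoef f = pser l 0 (fun j => f (- (j%:R / l%:R))).
Proof.
move=> f0; have [l [N [l0 H]]] := pcoefP f; exists l; split=> //; apply/funext => q.
have l0' : l%:R != 0 :> rat by rewrite pnatr_eq0 -lt0n.
rewrite /pser sub0r; case: ifPn => [/natrP[j Ej]|nn].
  by rewrite Ej natrK -Ej mulfK // opprK.
apply/eqP; apply: contraNT nn => fq; have [_ qi] := H _ fq.
rewrite natrEint mulNr rpredN qi /= -mulNr mulr_ge0 // oppr_ge0 leNgt.
by apply: contraNN fq => /f0 ->.
Qed.

(** Hensel's lemma for the ring of series of degree at most 0, whose residue map
    is the coefficient at exponent 0.  Read in [puiseux {poly K}], a product of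
    polynomials is a convolution of sequences of polynomials over K. *)
Lemma hensel (p : {poly puiseux K}) (g h : {poly K}) :
  p \is monic -> (forall i, pdle 0 p`_i) -> swap p 0 = g * h ->
  g \is monic -> h \is monic -> coprimep g h ->
  exists G H : {poly puiseux K}, [/\ p = G * H, G \is monic & size G = size g].
Proof.
move=> pm p0 pgh gm hm cop.
have g0 := monic_neq0 gm; have h0 := monic_neq0 hm.
have sg : (0 < size g)%N by rewrite size_poly_gt0.
have sh : (0 < size h)%N by rewrite size_poly_gt0.
have sp0 : size (swap p 0) = size p.
  have -> : swap p 0 = \poly_(k < size p) p`_k 0.
    apply/polyP => k; rewrite swapE coef_poly; case: ltnP => // /(nth_default 0) ->.
    exact: pcoef0.
  by apply: size_poly_eq; rewrite -lead_coefE (monicP pm) pcoef1 oner_neq0.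
have sp : (size p).-1 = ((size g).-1 + (size h).-1)%N.
  by rewrite -sp0 pgh size_mul //; move: sg sh; move: (size g) (size h) => i j; lia.
have [|l [l0 Ep]] := pser0_repr (f := swap p).
  by move=> r r0; apply/polyP => k; rewrite swapE (p0 k) ?coef0.
pose F j := swap p (- (j%:R / l%:R)).
have [||G [H [G0 H0 sGH FGH]]] := @hensel_series K F g h gm hm cop.
- by rewrite /F mul0r oppr0.
- move=> j j0; rewrite -sp; apply/leq_sizeP => k pk; rewrite swapE.
  move: pk; rewrite leq_eqVlt => /orP[/eqP <-|pk].
    rewrite -lead_coefE (monicP pm) pcoef1 oppr_eq0 mulf_eq0 invr_eq0 !pnatr_eq0.
    by rewrite !gtn_eqF.
  by rewrite nth_default ?pcoef0 //; move: pk; case: (size p).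
pose gg := Puiseux (pser_supp 0 G l0); pose hh := Puiseux (pser_supp 0 H l0).
have bound (s : nat -> {poly K}) t : s 0%N = t ->
  (forall j, (0 < j)%N -> (size (s j) < size t)%N) ->
  forall q, (size (pser l 0 s q) <= size t)%N.
  move=> s0 sj q; have [[i ->]|->] := pserP 0 s q l0; last by rewrite size_poly0.
  by rewrite pserE //; case: i => [|i]; rewrite ?s0 // ltnW // sj.
have sgg : swap (unswap (size g) gg) = gg.
  by apply/swap_unswap/bound => // j /sGH[].
have shh : swap (unswap (size h) hh) = hh.
  by apply/swap_unswap/bound => // j /sGH[].
exists (unswap (size g) gg), (unswap (size h) hh).
have lead : (unswap (size g) gg)`_(size g).-1 = 1.
  rewrite coef_poly prednK // leqnn; apply: puiseux_eqP => q.
  rewrite pcoef1 [LHS]/=; have [[i ->]|E] := pserP 0 G q l0; last first.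
    rewrite E coef0; case: eqP => // q0; move: E.
    have -> : q = 0%:R - 0%:R / l%:R by rewrite q0 mul0r subr0.
    by rewrite pserE // G0 => /eqP; rewrite (negPf g0).
  rewrite pserE // sub0r oppr_eq0 mulf_eq0 invr_eq0 !pnatr_eq0 (gtn_eqF l0) orbF.
  case: i => [|i]; first by rewrite G0 -lead_coefE (monicP gm).
  have [|sG _] := sGH i.+1; first by [].
  by rewrite nth_default //; move: sG; case: (size g).
have sG : size (unswap (size g) gg) = size g.
  by apply: size_poly_eq; move: lead; rewrite coef_poly prednK // leqnn => ->; rewrite oner_neq0.
split=> //; last by rewrite monicE lead_coefE sG lead.
apply: swap_inj; rewrite swapM sgg shh; apply: puiseuxP; rewrite Ep /= pmul_pser //.
by congr pser; apply/funext => j; rewrite -/(F j) FGH.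
Qed.

End Swap.

Section NewtonPuiseux.
Variable K : closedFieldType.
Hypothesis charK : [pchar K] =i pred0.
Implicit Types (p : {poly puiseux K}).

Lemma coef_exp_XsubC (R : comNzRingType) (r : R) k :
  (('X - r%:P) ^+ k.+1)`_k = - (r *+ k.+1).
Proof.
have -> : ('X - r%:P) ^+ k.+1 = \prod_(z <- nseq k.+1 r) ('X - z%:P).
  by rewrite big_nseq iter_mulr_1.
have := @coefPn_prod_XsubC R (nseq k.+1 r) isT.
by rewrite size_nseq => ->; rewrite big_nseq iter_addr_0.
Qed.

(** A polynomial with a single root r is a power of X - r, whose second
    coefficient vanishes only for r = 0; this is where the characteristic
    enters. *)
Lemma depressed_split (f : {poly K}) k : f \is monic -> size f = k.+2 -> f`_k = 0 ->
  (exists2 i, (i < k.+1)%N & f`_i != 0) ->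
  exists g h : {poly K}, [/\ f = g * h, g \is monic, h \is monic, coprimep g h &
    (1 < size g < size f)%N].
Proof.
move=> fm sf fk [i ik fi].
have /closed_rootP[r fr] : size f != 1%N by rewrite sf.
have [e [h /implyP hr Ef]] := multiplicity_XsubC f r.
have {}hr := hr (monic_neq0 fm).
have gm : ('X - r%:P) ^+ e \is monic by rewrite monic_exp ?monicXsubC.
have hm : h \is monic by rewrite -(monicMr _ gm) -Ef.
have cop : coprimep (('X - r%:P) ^+ e) h by rewrite coprimep_expl // coprimep_sym coprimep_XsubC.
exists (('X - r%:P) ^+ e), h; rewrite mulrC size_exp_XsubC; split=> //.
have e0 : (0 < e)%N.
  case: e {gm cop} Ef => // Ef; move: fr hr; by rewrite Ef expr0 mulr1 => ->.
have sfe : size f = (size h + e)%N.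
  by rewrite Ef size_Mmonic ?monic_neq0 ?size_exp_XsubC // addnS.
rewrite ltnS e0 /= sfe; have [h1|h1] := ltnP 1 (size h).
  move: h1; move: (size h) => u; lia.
have h1' : size h = 1%N by apply/eqP; rewrite eqn_leq h1 size_poly_gt0 monic_neq0.
have hE : h = 1.
  have /size_poly1P[c _ hc] : size h == 1%N by rewrite h1'.
  by move: hm; rewrite hc monicE lead_coefC => /eqP ->.
have ek : e = k.+1 by move: sfe; rewrite sf h1'; lia.
have : r *+ k.+1 = 0.
  by apply/eqP; rewrite -oppr_eq0 -fk Ef hE mul1r ek coef_exp_XsubC.
rewrite -mulr_natr => /eqP; rewrite mulf_eq0 natr_char0_eq0 // orbF => /eqP r0.
by move: fi; rewrite Ef hE mul1r r0 subr0 ek coefXn ltn_eqF // eqxx.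
Qed.

Lemma coef_comp_XaddC (R : comNzRingType) (q : {poly R}) k c :
  q \is monic -> size q = k.+2 ->
  (q \Po ('X + c%:P))`_k = q`_k + c *+ k.+1.
Proof.
move=> qm sq.
have sX j : size (('X + c%:P) ^+ j) = j.+1.
  by rewrite -(opprK c) polyCN size_exp_XsubC.
have lX j : (('X + c%:P) ^+ j)`_j = 1.
  have : ('X + c%:P) ^+ j \is monic by rewrite monic_exp // -(opprK c) polyCN monicXsubC.
  by rewrite monicE lead_coefE sX => /eqP.
have q1 : q`_k.+1 = 1 by move: qm; rewrite monicE lead_coefE sq => /eqP.
rewrite coef_comp_poly sq !big_ord_recr /= q1 lX mulr1 mul1r big1 ?add0r => [|i _].
  by congr (_ + _); rewrite -{1}(opprK c) polyCN coef_exp_XsubC mulNrn opprK.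
by rewrite [_`_k]nth_default ?mulr0 // sX.
Qed.

(** The Newton polygon argument.  Rescaling y by x^w, with w the steepest slope,
    brings all coefficients to degree at most 0 and some lower one to degree
    exactly 0, so that the residue polynomial splits and the factorisation lifts. *)
Lemma monic_depressed_root p k : p \is monic -> size p = k.+2 -> p`_k = 0 ->
  (forall q : {poly puiseux K}, q \is monic -> (1 < size q < size p)%N -> exists r, root q r) ->
  exists r, root p r.
Proof.
move=> pm sp pk IH.
have [i0 pi0|all0] := pickP (fun i : 'I_k.+1 => p`_i != 0); last first.
  exists 0; rewrite rootE horner_coef0; apply/negPn/negP => p00.
  by have := all0 ord0; rewrite p00.
pose wt (i : 'I_k.+1) : rat := pdeg p`_i / (k.+1 - i)%:R.
case: (arg_maxP (P := fun i : 'I_k.+1 => p`_i != 0) wt pi0) => i1 pi1 max1.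
set w := wt i1 in max1.
have pos (i : 'I_k.+1) : 0 < (k.+1 - i)%:R :> rat by rewrite ltr0n subn_gt0.
pose cf i := p`_i * pmono (- (w * (k.+1%:R - i%:R))) 1.
pose pt := \poly_(i < k.+2) cf i.
have cfE i q : cf i q = p`_i (q + w * (k.+1%:R - i%:R)).
  by rewrite /cf pcoef_mulmono opprK mulr1.
have p1 : p`_k.+1 = 1 by move: pm; rewrite monicE lead_coefE sp => /eqP.
have cfk : cf k.+1 = 1 by rewrite /cf p1 subrr mulr0 oppr0 mul1r.
have spt : size pt = k.+2 by apply: size_poly_eq; rewrite cfk oner_neq0.
have ptm : pt \is monic by rewrite monicE lead_coefE spt coef_poly ltnSn cfk.
have pt0 i : pdle 0 pt`_i.
  rewrite coef_poly; case: ltnP => [ik|_]; last exact: pdle0.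
  move: ik; rewrite ltnS leq_eqVlt => /orP[/eqP ->|ik]; first by rewrite cfk; apply: pdle1.
  move=> r r0; rewrite cfE; have [->|pi] := eqVneq p`_i 0; first by rewrite pcoef0.
  have [_] := pdegP pi; apply; have : wt (Ordinal ik) <= w := max1 (Ordinal ik) pi.
  rewrite /wt -/w ler_pdivrMr ?pos //= natrB ?(ltnW ik) // => le; lra.
have f_coef i : (i < k.+2)%N -> (swap pt 0)`_i = p`_i (w * (k.+1%:R - i%:R)).
  by move=> ik; rewrite swapE coef_poly ik cfE add0r.
have f1 : (swap pt 0)`_k.+1 = 1.
  by rewrite f_coef // p1 subrr mulr0 pcoef1 eqxx.
have sf : size (swap pt 0) = k.+2.
  apply/eqP; rewrite eqn_leq; apply/andP; split.
    by apply/leq_sizeP => j kj; rewrite swapE nth_default ?spt // pcoef0.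
  by rewrite ltnNge; apply/negP => /leq_sizeP/(_ _ (leqnn _)); rewrite f1 => /eqP; rewrite oner_eq0.
have fm : swap pt 0 \is monic by rewrite monicE lead_coefE sf f1.
have [||g [h [fgh gm hm cop sg]]] := depressed_split fm sf.
- by rewrite f_coef // pk pcoef0.
- exists i1 => //; rewrite f_coef; last exact: leq_trans (ltn_ord i1) _.
  have -> : w * (k.+1%:R - i1%:R) = pdeg p`_i1.
    by rewrite /w /wt natrB ?(ltnW (ltn_ord i1)) // mulfVK // -natrB ?(ltnW (ltn_ord i1)) // gt_eqF.
  by have [] := pdegP pi1.
have [G [H [ptE Gm sG]]] := hensel ptm pt0 fgh gm hm cop.
have [|rho Grho] := IH G Gm; first by rewrite sG sp -sf.
exists (pmono w 1 * rho).
have pt_rho : pt.[rho] = 0 by rewrite ptE hornerM (rootP Grho) mul0r.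
apply/rootP; rewrite horner_coef sp.
suff -> : \sum_(i < k.+2) p`_i * (pmono w 1 * rho) ^+ i = pmono (w * k.+1%:R) 1 * pt.[rho].
  by rewrite pt_rho mulr0.
rewrite horner_poly mulr_sumr; apply: eq_bigr => i _.
have mX j : pmono w 1 ^+ j = pmono (w * j%:R) 1 :> puiseux K.
  elim: j => [|j IHj]; first by rewrite expr0 mulr0.
  by rewrite exprS IHj pmonoM mulr1 -natr1; congr pmono; ring.
have -> : pmono (w * k.+1%:R) 1 * (cf i * rho ^+ i) =
    p`_i * (pmono (w * k.+1%:R) 1 * pmono (- (w * (k.+1%:R - i%:R))) 1) * rho ^+ i.
  by rewrite /cf; ring.
rewrite pmonoM mulr1.
have -> : w * k.+1%:R - w * (k.+1%:R - i%:R) = w * i%:R by ring.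
rewrite exprMn mX; exact: (mulrA p`_i).
Qed.

(** Translating by the mean of the roots removes the second coefficient. *)
Lemma monic_root p : p \is monic -> (1 < size p)%N -> exists r, root p r.
Proof.
have [n] := ubnP (size p); elim: n p => // n IH p pn pm p1.
case sp: (size p) p1 pn => [|[|k]] // _; rewrite ltnS => kn.
pose c : puiseux K := - (pmono 0 (k.+1%:R^-1) * p`_k).
pose q := p \Po ('X + c%:P).
have X2 : size ('X + c%:P) = 2 by rewrite -(opprK c) polyCN size_XsubC.
have sq : size q = k.+2 by rewrite /q size_comp_poly2.
have qm : q \is monic.
  rewrite monicE /q lead_coef_comp ?X2 // -(opprK c) polyCN lead_coefXsubC expr1n mulr1.
  by rewrite -monicE.
have qk : q`_k = 0.
  rewrite /q coef_comp_XaddC // /c mulNrn -mulrnAl.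
  have -> : pmono 0 k.+1%:R^-1 *+ k.+1 = 1 :> puiseux K.
    rewrite -[LHS]mulr_natl -[k.+1%:R](_ : pmono 0 k.+1%:R = _).
      by rewrite pmonoM addr0 mulfV // natr_char0_eq0.
    by apply: puiseux_eqP => r; elim: (k.+1) => [|j IHj]; rewrite ?mulr0n ?pmono0 // -!natr1 pmonoD pcoefD IHj.
  by rewrite mul1r subrr.
have [|r /rootP qr] := monic_depressed_root qm sq qk.
  by move=> g gm; rewrite sq => /andP[g1 gk]; apply: IH => //; apply: leq_trans kn.
exists (r + c); apply/rootP; move: qr; rewrite /q horner_comp.
by rewrite hornerD hornerX hornerC.
Qed.

Theorem newton_puiseux p : p \is monic ->
  exists rs, p = \prod_(alpha <- rs) ('X - alpha%:P).
Proof.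
have [n] := ubnP (size p); elim: n p => // n IH p pn pm.
have [p1|p1] := leqP (size p) 1.
  exists [::]; rewrite big_nil.
  have /size_poly1P[c _ E] : size p == 1%N by rewrite eqn_leq p1 size_poly_gt0 monic_neq0.
  by move: pm; rewrite E monicE lead_coefC => /eqP ->.
have [r /factor_theorem[q E]] := monic_root pm p1.
have qm : q \is monic by rewrite -(monicMr _ (monicXsubC r)) -E.
have [|rs qE] := IH q _ qm; first by move: pn; rewrite E size_Mmonic ?monicXsubC ?monic_neq0 // size_XsubC addn2.
by exists (r :: rs); rewrite E qE big_cons mulrC.
Qed.

End NewtonPuiseux.


(** * Resultants and roots *)

Section ResultantOfRoots.

Lemma Sylvester_row_horner (R : comNzRingType) (r : {poly R}) (k d : nat) (x : R) :
  (k + size r <= d)%N ->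
  \sum_(j < d) (r`_(j - k) *+ (k <= j)%N) * x ^+ j = x ^+ k * r.[x].
Proof.
move=> kd; rewrite -hornerXn -hornerM (@horner_coef_wide _ d); last first.
  by rewrite (leq_trans (size_polyMleq _ _)) // size_polyXn addSn.
apply: eq_bigr => j _; rewrite coefXnM ltnNge; by case: leqP; rewrite ?mulr0n ?mulr1n.
Qed.

Lemma rot_ord_subproof k d (i : 'I_(k + d)) : ((if (i < k)%N then d + i else i - k) < k + d)%N.
Proof. by case: (ltnP i k) => ik; have := ltn_ord i; lia. Qed.

Definition rot_ord k d (i : 'I_(k + d)) : 'I_(k + d) := Ordinal (rot_ord_subproof i).

(** This permutation moves the unit vectors of the matrix used below to its top
    left corner. *)
Lemma rot_ord_inj k d : injective (@rot_ord k d).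
Proof.
move=> i j /(congr1 val) /= E; apply: val_inj => /=; move: E.
case: (ltnP i k) => ik; case: (ltnP j k) => jk E; have := ltn_ord i; have := ltn_ord j; lia.
Qed.

(** The Sylvester matrix of p and q times the matrix whose columns are the top
    unit vectors and the vectors (1, a, a^2, ...) for the roots a of p is block
    triangular, because the rows of p evaluate to 0 at a and the rows of q to
    a^k q(a). *)
Lemma resultant_uniq_roots (R : idomainType) (rs : seq R) (q : {poly R}) :
  uniq rs -> exists e : nat,
    resultant (\prod_(a <- rs) ('X - a%:P)) q = (-1) ^+ e * \prod_(a <- rs) q.[a].
Proof.
move=> urs; set p := \prod_(a <- rs) _.
have sp : size p = (size rs).+1 by rewrite size_prod_XsubC.
have pm : p \is monic by apply: monic_prod_XsubC.
set dp := (size p).-1; set dq := (size q).-1.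
have dpE : dp = size rs by rewrite /dp sp.
pose al (c : 'I_dp) := rs`_c.
have al_root c : root p (al c).
  by rewrite root_prod_XsubC mem_nth // -dpE.
pose a := \row_c al c.
pose E : 'M[R]_(dq + dp, dq) := \matrix_(j, c) (j == dp + c :> nat)%:R.
pose V : 'M[R]_(dq + dp, dp) := \matrix_(j, c) al c ^+ j.
pose U : 'M[R]_dq := \matrix_(k, c) (p`_(dp + c - k) *+ (k <= dp + c)%N).
pose W : 'M[R]_dp := Vandermonde dp a *m diag_mx (\row_c q.[al c]).
have [S [detS Su Sd]] : exists S : 'M[R]_(dq + dp), [/\ \det S = resultant p q,
    forall k (j : 'I_(dq + dp)), S (lshift dp k) j = p`_(j - k) *+ (k <= j)%N &
    forall k (j : 'I_(dq + dp)), S (rshift dq k) j = q`_(j - k) *+ (k <= j)%N].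
  exists (Sylvester_mx p q); split=> // k j.
    by rewrite Sylvester_mxE (unsplitK (inl k)).
  by rewrite Sylvester_mxE (unsplitK (inr k)).
have [X SE] : exists X : 'M_(dp, dq), S *m row_mx E V = block_mx U 0 X W.
  exists (dsubmx S *m E).
  rewrite -{1}(vsubmxK S) mul_col_row; congr block_mx.
  - apply/matrixP => k c; rewrite !mxE.
    have lt : (dp + c < dq + dp)%N by rewrite addnC ltn_add2r.
    rewrite (bigD1 (Ordinal lt)) //= !mxE Su eqxx mulr1 big1 ?addr0 //.
    by move=> j; rewrite -val_eqE /= !mxE => /negPf ->; rewrite mulr0.
  - apply/matrixP => k c; rewrite !mxE.
    under eq_bigr => j _ do rewrite !mxE Su.
    rewrite Sylvester_row_horner ?(rootP (al_root c)) ?mulr0 //.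
    by rewrite sp -dpE addnS -addSn leq_add2r.
  - rewrite /W mul_mx_diag; apply/matrixP => k c; rewrite !mxE.
    under eq_bigr => j _ do rewrite !mxE Sd.
    rewrite Sylvester_row_horner // /dq; have [->|q0] := eqVneq q 0.
      by rewrite size_poly0 addn0 add0n ltnW.
    have : (0 < size q)%N by rewrite size_poly_gt0.
    by have := ltn_ord k; move: (size q) => sq; lia.
have detT : exists e : nat, \det (row_mx E V) = (-1) ^+ e * \det (Vandermonde dp a).
  exists (perm (@rot_ord_inj dq dp) : bool); set s := perm _.
  have /(congr1 (determinant (n := _))) : row_perm s (row_mx E V) =
      block_mx 1%:M (\matrix_(j, c) al c ^+ (dp + j)) 0 (Vandermonde dp a).
    apply/matrixP => i j; rewrite mxE permE.
    rewrite -[i]splitK -[j]splitK; case: (fintype.split i) (fintype.split j) => k [c|c] /=.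
    - rewrite row_mxEl block_mxEul !mxE /= ltn_ord eqn_add2l.
      by rewrite eq_sym; congr (_%:R); rewrite eq_sym.
    - by rewrite row_mxEr block_mxEur !mxE /= ltn_ord.
    - rewrite row_mxEl block_mxEdl !mxE /= ltnNge leq_addr /= addKn.
      by rewrite ltn_eqF // ltn_addr.
    - by rewrite row_mxEr block_mxEdr !mxE /= ltnNge leq_addr /= addKn.
  rewrite det_ublock det1 mul1r row_permE det_mulmx det_perm => <-.
  by rewrite mulrA -signr_addb addbb mul1r.
have [e detE] := detT.
have detU : \det U = 1.
  rewrite det_trig; last first.
    apply/is_trig_mxP => k c kc; rewrite mxE nth_default ?mul0rn // sp.
    by rewrite -dpE; lia.
  apply: big1 => k _; rewrite mxE addnK leq_addl mulr1n.
  by move: pm; rewrite monicE lead_coefE => /eqP.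
have detV0 : \det (Vandermonde dp a) != 0.
  rewrite det_Vandermonde; apply/prodf_neq0 => i _; apply/prodf_neq0 => j ij.
  rewrite !mxE subr_eq0 /al nth_uniq -?dpE //; by rewrite gtn_eqF.
have /(congr1 (determinant (n := _))) := SE.
rewrite det_lblock detU mul1r !det_mulmx detE det_diag detS mulrA mulrC => /(mulfI detV0) H.
have {}H : resultant p q = (-1) ^+ e * \prod_i (\row_c q.[al c]) 0 i.
  by rewrite -H mulrCA -expr2 sqrr_sign mulr1.
exists e; rewrite H; congr (_ * _).
rewrite (big_nth 0) big_mkord -dpE; by apply: eq_bigr => c _; rewrite mxE.
Qed.

(** Repeated roots are separated by moving the i-th root a_i to a_i + i z. *)
Lemma resultant_roots (R : idomainType) (rs : seq R) (q : {poly R}) :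
  [pchar R] =i pred0 -> q != 0 -> exists e : nat,
    resultant (\prod_(a <- rs) ('X - a%:P)) q = (-1) ^+ e * \prod_(a <- rs) q.[a].
Proof.
move=> charR q0; pose b i : {poly R} := (rs`_i)%:P + i%:R *: 'X.
have binj : injective b.
  move=> i j /(congr1 (coefp 1)) /=; rewrite !coefD !coefC !coefZ !coefX /= !add0r !mulr1.
  move=> /eqP; rewrite -subr_eq0; wlog ij : i j / (j <= i)%N.
    move=> W; case: (leqP j i) => [|/ltnW ij]; first exact: W.
    by rewrite -opprB oppr_eq0 => /(W _ _ ij).
  rewrite -natrB // (pcharf0P R).1 // subn_eq0 => ji.
  by apply/eqP; rewrite eqn_leq ji.
pose bs := [seq b i | i <- iota 0 (size rs)].
have ubs : uniq bs by rewrite map_inj_uniq // iota_uniq.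
have b0 i : (b i).[0] = rs`_i by rewrite !hornerE.
have rsE : rs = [seq p.[0] | p <- bs].
  rewrite -map_comp -[LHS](mkseq_nth 0); apply: eq_map => i /=; by rewrite b0.
clearbody bs.
have [e E] := resultant_uniq_roots (map_poly polyC q) ubs; exists e.
pose ev0 : {rmorphism {poly R} -> R} := horner_eval 0.
have ev0E p : ev0 p = p.[0] by [].
have evq : map_poly ev0 (map_poly polyC q) = q.
  by rewrite -map_poly_comp map_poly_id // => c _ /=; rewrite ev0E hornerC.
have mapP : map_poly ev0 (\prod_(a <- bs) ('X - a%:P)) = \prod_(a <- rs) ('X - a%:P).
  rewrite [in RHS]rsE big_map rmorph_prod; apply: eq_bigr => i _.
  by rewrite rmorphB /= map_polyX map_polyC.
have evE : ev0 (\prod_(a <- bs) (map_poly polyC q).[a]) = \prod_(a <- rs) q.[a].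
  rewrite [in RHS]rsE big_map rmorph_prod; apply: eq_bigr => i _.
  by rewrite -ev0E -[in RHS]evq horner_map.
have /(congr1 ev0) := E; rewrite map_resultant.
- by rewrite mapP evq rmorphM rmorphXn rmorphN1 evE.
- by rewrite (monicP (monic_prod_XsubC _ _ _)) rmorph1 oner_neq0.
- by rewrite lead_coef_map_inj //= ?ev0E ?hornerC ?lead_coef_eq0 //; apply: polyC_inj.
Qed.

End ResultantOfRoots.

Section IntersectionNumber.
Variable K : closedFieldType.
Hypothesis charK : [pchar K] =i pred0.

Lemma pchar_puiseux : [pchar (puiseux K)] =i pred0.
Proof.
apply/(pcharf0P _).2 => n.
have -> : n%:R = pmono 0 n%:R :> puiseux K.
  by elim: n => [|n IH]; rewrite ?pmono0 // -!natr1 pmonoD IH.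
have [->|n0] := eqVneq n 0%N; first by rewrite pmono0 eqxx.
by apply/negP/negP/pmono_neq0; rewrite natr_char0_eq0.
Qed.

Lemma pdeg_exprN1 e (f : puiseux K) : f != 0 -> (-1) ^+ e * f != 0 /\ pdeg ((-1) ^+ e * f) = pdeg f.
Proof.
move=> f0; have [f1 f2] := pdegP f0; rewrite -signr_odd mulr_sign.
case: (odd e); rewrite ?oppr_eq0 //; split=> //; apply: pdeg_eq; last exact: pdleN.
by rewrite pcoefN oppr_eq0.
Qed.

Lemma pdeg_resultant (F G : {poly {poly K}}) rs : F \is monic -> has_roots F rs -> G != 0 ->
  (forall alpha, alpha \in rs -> ev G alpha != 0) ->
  (intersection_number F G)%:R = \sum_(alpha <- rs) pdeg (ev G alpha).
Proof.
move=> Fm FE G0 Grs.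
have inj := @pofpoly_inj K.
have G0' : map_poly (@pofpoly K) G != 0.
  by rewrite -lead_coef_eq0 lead_coef_map_inj ?raddf0 // raddf_eq0 // lead_coef_eq0.
have [e E] := resultant_roots rs pchar_puiseux G0'.
have RE : pofpoly (resultant F G) = (-1) ^+ e * \prod_(alpha <- rs) ev G alpha.
  rewrite map_resultant ?FE ?(monicP Fm) ?rmorph1 ?oner_neq0 //.
  by rewrite raddf_eq0 // lead_coef_eq0.
have P0 : \prod_(alpha <- rs) ev G alpha != 0.
  by rewrite prodf_seq_neq0; apply/allP => alpha /Grs.
have [n0 dE] := pdeg_exprN1 e P0.
have R0 : resultant F G != 0 by apply: contraNneq n0 => R0; rewrite -RE R0 raddf0.
by rewrite -pdeg_pofpoly // RE dE pdeg_prod.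
Qed.

End IntersectionNumber.


(** * Descending along a root *)

Lemma ratr_char0_inj (K : fieldType) : [pchar K] =i pred0 -> injective (@ratr K).
Proof.
move=> charK x y E; apply/eqP; rewrite -subr_eq0 -(ratr_char0_eq0 charK).
by rewrite -(inj_eq (addIr (ratr y))) add0r -ratr_char0D // subrK E.
Qed.

Lemma ratr_char0Mn (K : fieldType) : [pchar K] =i pred0 ->
  forall x k, ratr (x * k%:R) = ratr x * k%:R :> K.
Proof.
move=> charK x; elim=> [|k IH]; last by rewrite -!natr1 !mulrDr !mulr1 ratr_char0D // IH.
by rewrite !mulr0; apply/eqP; rewrite ratr_char0_eq0.
Qed.

Section MultiplicityRelation.
Variable K : fieldType.
Implicit Types (f g : {poly K}) (x y r : K).

Lemma XsubC_mul_deriv_exp r k : ('X - r%:P) * (('X - r%:P) ^+ k)^`() = ('X - r%:P) ^+ k *+ k.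
Proof.
case: k => [|k]; first by rewrite expr0 derivC mulr0.
by rewrite deriv_exp derivXsubC mul1r mulrnAr -exprS.
Qed.

(** Multiply by X - r, divide by (X - r)^(mu + nu) and evaluate at r. *)
Lemma multiplicity_relation f g x y r mu nu : f.[r] != 0 -> g.[r] != 0 ->
  let F := ('X - r%:P) ^+ mu * f in let G := ('X - r%:P) ^+ nu * g in
  x%:P * F * G^`() - y%:P * F^`() * G = 0 -> x * nu%:R = y * mu%:R.
Proof.
set Z := 'X - r%:P => fr gr F G E.
have Zn0 k : Z ^+ k != 0 by rewrite expf_neq0 // polyXsubC_eq0.
have ZF : Z * F^`() = Z ^+ mu * (mu%:R%:P * f + Z * f^`()).
  rewrite derivM mulrDr mulrA XsubC_mul_deriv_exp polyC_natr; ring.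
have ZG : Z * G^`() = Z ^+ nu * (nu%:R%:P * g + Z * g^`()).
  rewrite derivM mulrDr mulrA XsubC_mul_deriv_exp polyC_natr; ring.
have : Z ^+ (mu + nu) * (x%:P * f * (nu%:R%:P * g + Z * g^`())
    - y%:P * (mu%:R%:P * f + Z * f^`()) * g) = 0.
  rewrite exprD.
  transitivity (Z * (x%:P * F * G^`() - y%:P * F^`() * G)); last by rewrite E mulr0.
  have -> : Z * (x%:P * F * G^`() - y%:P * F^`() * G) = x%:P * F * (Z * G^`()) - y%:P * (Z * F^`()) * G by ring.
  by rewrite ZF ZG /F /G; ring.
move=> /eqP; rewrite mulf_eq0 (negPf (Zn0 _)) /= => /eqP /(congr1 (horner^~ r)) /=.
rewrite /Z !(hornerD, hornerN, hornerM, hornerC, hornerX) ?horner0 subrr !mul0r !addr0.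
move=> /eqP; rewrite subr_eq0 => /eqP H.
have fg0 : f.[r] * g.[r] != 0 by rewrite mulf_neq0.
apply: (mulIf fg0).
transitivity (x * f.[r] * (nu%:R * g.[r])); first ring.
by rewrite H; ring.
Qed.

End MultiplicityRelation.

Section Descent.
Variable K : closedFieldType.
Implicit Types (alpha beta : puiseux K) (rs : seq (puiseux K)) (F G : {poly {poly K}}).

(** Agreement with [alpha] at x^t and above. *)
Definition closer alpha (t : rat) beta := (alpha == beta) || (pdeg (alpha - beta) < t).
Definition mu alpha t rs := count (closer alpha t) rs.

Lemma closerE alpha t beta :
  closer alpha t beta = `[< agrees beta (approx alpha t) >] && (beta t == alpha t).
Proof.
have agE := agreesE beta (@agrees_approx _ alpha t).
apply/idP/andP; rewrite /closer.
  move=> /orP[/eqP <-|lt]; first by split=> //; apply/asboolP; apply: agrees_approx.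
  split; first by apply/asboolP; apply: agE.2; right; apply: ltW.
  have [->|ne] := eqVneq alpha beta; first exact: eqxx.
  rewrite -subr_eq0 in ne; have [_ /(_ _ lt)] := pdegP ne.
  by rewrite pcoefB => /eqP; rewrite subr_eq0 eq_sym.
move=> [/asboolP bag bt]; have [->|/= le] := agE.1 bag; first by rewrite eqxx.
have [//|ne] := eqVneq alpha beta; rewrite lt_neqAle le andbT /=.
rewrite -subr_eq0 in ne; have [lead _] := pdegP ne.
by apply: contraNneq lead => ->; rewrite pcoefB (eqP bt) subrr.
Qed.

Lemma fpoly_multiplicity F rs alpha t : has_roots F rs ->
  exists2 f : {poly K}, f.[alpha t] != 0 &
    fpoly F (approx alpha t) = ('X - (alpha t)%:P) ^+ mu alpha t rs * f.
Proof.
move=> FE; have [_ [c c0 ->]] := fpolyP FE (@approx_truncated _ alpha t).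
pose s := Dtau rs (approx alpha t).
exists (c%:P * \prod_(beta <- s | beta t != alpha t) ('X - (beta t)%:P)).
  rewrite hornerM hornerC mulf_neq0 // horner_prod prodf_seq_neq0.
  by apply/allP => beta _; apply/implyP => bt; rewrite hornerXsubC subr_eq0 eq_sym.
rewrite (bigID (fun beta : puiseux K => beta t == alpha t)) /= mulrCA; congr (_ * _).
have -> : mu alpha t rs = count (fun beta : puiseux K => beta t == alpha t) s.
  rewrite count_filter /mu; apply: eq_count => beta.
  by rewrite closerE /= andbC.
rewrite (eq_bigr (fun _ => 'X - (alpha t)%:P)) => [|beta /eqP -> //].
by rewrite big_const_seq iter_mulr_1.
Qed.

(** Between two consecutive exponents at which roots separate from [alpha], the
    level is an affine function whose slope counts the roots not yet separated. *)
Lemma Lev_segment alpha s t j rs : s <= j < t ->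
  (forall beta, beta \in rs -> alpha != beta ->
     pdeg (alpha - beta) <= s \/ t <= pdeg (alpha - beta)) ->
  Lev alpha j rs = Lev alpha t rs - (t - j) * (mu alpha t rs)%:R /\
  size (Dtau rs (approx alpha j)) = mu alpha t rs.
Proof.
move=> /andP[sj jt] gap.
have agE beta : beta \in rs -> `[< agrees beta (approx alpha j) >] = closer alpha t beta.
  move=> brs; apply/asboolP/idP => [/(agreesE _ (@agrees_approx _ alpha j)) [->|/= le]|].
  - by rewrite /closer eqxx.
  - by rewrite /closer (le_lt_trans le jt) orbT.
  - move=> /orP[/eqP E|lt]; apply/(agreesE _ (@agrees_approx _ alpha j)); [by left|].
    have [E|ne] := eqVneq alpha beta; [by left|right].
    have [/le_trans|] := gap _ brs ne; first exact.
    by rewrite leNgt lt.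
split; last by rewrite size_filter /mu; apply: eq_in_count => beta /agE.
rewrite /Lev /mu; elim: rs gap {agE} => [|beta rs IH] gap; first by rewrite !big_nil /= mulr0 subr0.
rewrite !big_cons /= IH => [|b brs]; last by apply: gap; rewrite inE brs orbT.
suff -> : lev alpha j beta = lev alpha t beta - (t - j) * (closer alpha t beta)%:R.
  by rewrite natrD; ring.
rewrite /lev /closer; have [E|ne] := eqVneq alpha beta; first by rewrite /=; ring.
have [le|ge] := gap _ (mem_head _ _) ne.
  have lt : pdeg (alpha - beta) < t by lra.
  have le' : pdeg (alpha - beta) <= j by lra.
  by rewrite lt /= (max_idPl le') (max_idPl (ltW lt)); ring.
have le' : j <= pdeg (alpha - beta) by lra.
by rewrite ltNge ge /= (max_idPr le') (max_idPr ge) mulr0 subr0.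
Qed.

End Descent.


(** * Minor pi-roots *)

Lemma size_deriv_char0 (R : idomainType) (f : {poly R}) :
  [pchar R] =i pred0 -> size f^`() = (size f).-1.
Proof.
move=> charR; case sf: (size f) => [|[|k]].
- by move/eqP: sf; rewrite size_poly_eq0 => /eqP ->; rewrite deriv0 size_poly0.
- have /size_poly1P[d _ ->] : size f == 1%N by rewrite sf.
  by rewrite derivC size_poly0.
rewrite /deriv sf; apply: size_poly_eq.
rewrite -mulr_natr mulf_neq0 ?(pcharf0P R).1 //.
by rewrite -[k.+1]/(k.+2.-1) -sf -lead_coefE lead_coef_eq0 -size_poly_gt0 sf.
Qed.

Section Minor.
Variable K : closedFieldType.
Hypothesis charK : [pchar K] =i pred0.
Variables (P Q : {poly {poly K}}) (rootsP rootsQ : seq (puiseux K)) (c : K).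
Hypothesis PE : has_roots P rootsP.
Hypothesis QE : has_roots Q rootsQ.
Hypothesis jacPQ : jac P Q = c%:P%:P.
Hypothesis genericPQ : forall tau, pi_root rootsP tau -> lambda P tau = 0 ->
  no_multiple_root (fpoly P tau) /\ coprimep (fpoly P tau) (fpoly Q tau).

Implicit Types (alpha beta gamma : puiseux K) (tau : pi_approx K) (F : {poly {poly K}}).

Local Notation minor := (minor_pi_root P rootsP).

(** Differentiating F(tau) in pi brings out F_y(tau) and the factor x^j. *)
Lemma dy_top F tau q : psubst (dy F) tau q = (psubst F tau (q + tau.2))^`().
Proof.
rewrite -dpiE dpi_psubst pcoef_mulmono mulr1; congr (pcoef _ _); ring.
Qed.

Lemma pdle_dy F tau q : pdle q (psubst F tau) -> pdle (q - tau.2) (psubst (dy F) tau).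
Proof. by move=> H r rq; rewrite dy_top H ?deriv0 //; lra. Qed.

Lemma minor_truncated tau : minor tau -> truncated tau.
Proof. by case=> [[[]]]. Qed.

Lemma simple_root_deriv (f : {poly K}) r : f != 0 -> (mup r f <= 1)%N -> root f r ->
  ~~ root f^`() r.
Proof.
move=> f0 m1 fr; apply/negP => f'r; move: m1; rewrite leqNgt => /negP; apply.
rewrite mup_geq // ; case/factor_theorem: fr => g fE.
move: f'r; rewrite fE derivM derivXsubC mulr1 rootE hornerD hornerM hornerXsubC subrr mulr0 add0r.
by move=> /factor_theorem[h ->]; rewrite -mulrA -expr2 dvdp_mulIr.
Qed.

(** At level 0 the bracket reads [lambda_Q f' g = const] and [f'] has positive
    degree. *)
Lemma minor_lambdaQ tau : minor tau -> lambda Q tau = 0.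
Proof.
move=> mt; have tr := minor_truncated mt; case: mt => [[_ _ sf] lam0].
have [Ple _] := fpolyP PE tr; have [Qle _] := fpolyP QE tr.
have [k] := bracket_top charK jacPQ Ple Qle; rewrite -/(fpoly P tau) -/(fpoly Q tau) lam0.
have -> : ratr 0 = 0 :> K by apply/eqP; rewrite ratr_char0_eq0.
rewrite mul0r mul0r sub0r; set r := ratr _ => H.
have [/eqP|r0] := eqVneq r 0; first by rewrite /r ratr_char0_eq0 // => /eqP.
have f'1 : (1 < size (fpoly P tau)^`())%N by rewrite size_deriv_char0.
have g0 := fpoly_neq0 QE tr.
have f'0 : (fpoly P tau)^`() != 0 by rewrite -size_poly_gt0 ltnW.
have : (size (- (r%:P * (fpoly P tau)^`() * fpoly Q tau))%R <= 1)%N by rewrite H size_polyC_leq1.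
rewrite size_polyN -mulrA mul_polyC size_scale // size_mul //.
have : (0 < size (fpoly Q tau))%N by rewrite size_poly_gt0.
by move: f'1; move: (size _) (size _) => u v; lia.
Qed.

Lemma minor_ev_Q tau alpha : minor tau -> alpha \in Dtau rootsP tau ->
  pdeg (ev Q alpha) = 0.
Proof.
move=> mt aD; have tr := minor_truncated mt; have lQ := minor_lambdaQ mt.
move: (aD); rewrite mem_Dtau => /andP[/asboolP ag _].
have [Qle _] := fpolyP QE tr; rewrite lQ in Qle.
have [le E] := ev_top tr ag Qle; apply: pdeg_eq => //; rewrite E.
have fr := root_fpoly PE tr aD.
have [_ cop] := genericPQ (let: conj (And3 r _ _) _ := mt in r) (let: conj _ l := mt in l).
have := coprimep_root cop fr; by rewrite /fpoly lQ.
Qed.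

Lemma minor_ev_dyP tau alpha : minor tau -> alpha \in Dtau rootsP tau ->
  pdeg (ev (dy P) alpha) = - tau.2.
Proof.
move=> mt aD; have tr := minor_truncated mt; case: (mt) => [[_ nm _] l0].
move: (aD); rewrite mem_Dtau => /andP[/asboolP ag _].
have [Ple _] := fpolyP PE tr; rewrite l0 in Ple.
have [le E] := ev_top tr ag (pdle_dy Ple); rewrite sub0r in le E.
apply: pdeg_eq => //; rewrite E dy_top addNr -l0.
exact: (simple_root_deriv (fpoly_neq0 PE tr) (nm _) (root_fpoly PE tr aD)).
Qed.

(** The coefficient of [beta] is a root of f' and f has no multiple root, hence
    f does not vanish there. *)
Lemma minor_critical tau beta : minor tau -> agrees beta tau -> ev (dy P) beta = 0 ->
  pdeg (ev P beta) = 0 /\ pdle (- tau.2) (ev (dy Q) beta).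
Proof.
move=> mt ag crit; have tr := minor_truncated mt; case: (mt) => [[_ nm _] l0].
have [Ple _] := fpolyP PE tr; rewrite l0 in Ple.
have [Qle _] := fpolyP QE tr; rewrite minor_lambdaQ // in Qle.
split; last by have [] := ev_top tr ag (pdle_dy Qle); rewrite sub0r.
have [le E] := ev_top tr ag Ple; apply: pdeg_eq => //; rewrite E -l0 -rootE.
have [_] := ev_top tr ag (pdle_dy Ple); rewrite crit pcoef0 dy_top subrK => /esym/rootP f'r.
apply/negP => fr; have := simple_root_deriv (fpoly_neq0 PE tr) (nm _) fr.
by rewrite /fpoly l0 f'r.
Qed.

(** A critical value of degree 0 is taken at the distance of the nearest root. *)
Lemma critical_minor beta : rootsP != [::] -> ev (dy P) beta = 0 -> ev P beta != 0 ->
  pdeg (ev P beta) = 0 -> exists2 tau, minor tau & agrees beta tau.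
Proof.
move=> rP crit Pb0 dP.
have ne alpha : alpha \in rootsP -> beta != alpha.
  move=> aP; apply: contraNneq Pb0 => ->.
  by rewrite (ev_prod _ PE) (big_rem _ aP) /= subrr mul0r.
have [a0 a0P mina] : exists2 a0, a0 \in rootsP &
    forall alpha, alpha \in rootsP -> pdeg (beta - a0) <= pdeg (beta - alpha).
  elim: (rootsP) rP => // a s IH _; have [->|s0] := eqVneq s [::].
    by exists a; rewrite ?mem_head // => b; rewrite inE => /eqP ->.
  have [a1 a1s H] := IH s0; have [le|lt] := leP (pdeg (beta - a)) (pdeg (beta - a1)).
    exists a; first exact: mem_head.
    by move=> b; rewrite inE => /orP[/eqP -> //|/H]; apply: le_trans.
  exists a1; first by rewrite inE a1s orbT.
  by move=> b; rewrite inE => /orP[/eqP ->|/H //]; apply: ltW.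
set j := pdeg (beta - a0) in mina.
pose tau := approx beta j.
have tr : truncated tau := @approx_truncated _ _ _.
have ag : agrees beta tau := @agrees_approx _ _ _.
have lam : lambda P tau = 0.
  rewrite (lambdaE PE tr ag) -dP (ev_prod _ PE) pdeg_prod => [|alpha /ne]; last by rewrite subr_eq0.
  rewrite /Lev !big_seq; apply: eq_bigr => alpha aP; rewrite /lev (negPf (ne _ aP)).
  exact/max_idPr/mina.
have a0D : a0 \in Dtau rootsP tau.
  rewrite mem_Dtau a0P andbT; apply/asboolP/(agreesE _ ag); right; exact: lexx.
have pr : pi_root rootsP tau.
  by split=> // E; move: a0D; rewrite E.
have [nm _] := genericPQ pr lam.
exists tau => //; split=> //; split=> //.
have [Ple _] := fpolyP PE tr; rewrite lam in Ple.
have [_] := ev_top tr ag (pdle_dy Ple); rewrite crit pcoef0 dy_top subrK => f'r.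
have sf := size_fpoly PE tr.
rewrite sf /= ltnNge; apply/negP => D1.
have sf2 : size (fpoly P tau) = 2.
  rewrite sf; congr _.+1; apply/eqP; rewrite eqn_leq D1 /=.
  by case: (Dtau rootsP tau) a0D.
have /size_poly1P[d d0 E] : size (fpoly P tau)^`() == 1%N.
  by rewrite size_deriv_char0 // sf2.
by move: f'r; rewrite -lam -/(fpoly P tau) E hornerC => /esym/eqP; rewrite (negPf d0).
Qed.

(** Two such pi-roots are truncations of the same series, and the level along it is
    strictly increasing, hence 0 only once. *)
Lemma minor_unique tau tau' gamma : minor tau -> minor tau' ->
  agrees gamma tau -> agrees gamma tau' -> tau = tau'.
Proof.
wlog le : tau tau' / tau.2 <= tau'.2.
  move=> W mt mt' ag ag'; have [le|lt] := leP tau.2 tau'.2; first exact: W.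
  by apply/esym/W => //; apply: ltW.
move=> mt mt' ag ag'; have [tr tr'] := (minor_truncated mt, minor_truncated mt').
rewrite (approxE tr ag) (approxE tr' ag'); congr approx.
apply/eqP; rewrite eq_le le leNgt; apply/negP => lt.
case: (mt) (mt') => [[[_ Dne] _ _] l0] [_ l0'].
case D: (Dtau rootsP tau) Dne => [//|alpha s] _.
have : alpha \in Dtau rootsP tau by rewrite D mem_head.
rewrite mem_Dtau => /andP[/asboolP aag aP].
have := Lev_lt (gamma := gamma) (rs := rootsP) lt.
rewrite -(lambdaE PE tr ag) -(lambdaE PE tr' ag') l0 l0' ltxx; move=> H.
have // : false by apply: H; exists alpha => //; rewrite -(approxE tr ag).
Qed.

(** The leading polynomial of P_y at tau is f', up to a constant. *)
Lemma size_Dtau_dy tau rootsP' (N : K) : minor tau -> N != 0 ->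
  has_roots (N%:P *: dy P) rootsP' -> size (Dtau rootsP' tau) = (size (Dtau rootsP tau)).-1.
Proof.
move=> mt N0 PE'; have tr := minor_truncated mt; case: (mt) => [[_ nm s2] l0].
have [Ple _] := fpolyP PE tr; rewrite l0 in Ple.
have coefE q : psubst (N%:P *: dy P) tau q = N *: psubst (dy P) tau q.
  rewrite -mul_polyC psubstM psubstC mulrC pcoef_mulmono subr0.
  by rewrite mulrC mul_polyC.
have lead : psubst (N%:P *: dy P) tau (- tau.2) = N *: (fpoly P tau)^`().
  by rewrite coefE dy_top addNr /fpoly l0.
have lamE : lambda (N%:P *: dy P) tau = - tau.2.
  apply: pdeg_eq.
    rewrite lead scaler_eq0 negb_or N0 -size_poly_gt0 size_deriv_char0 //.
    exact: ltnW.
  by move=> r rq; rewrite coefE (pdle_dy Ple) ?scaler0 // sub0r.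
apply: succn_inj; rewrite -(size_fpoly PE' tr) /fpoly lamE lead size_scale //.
by rewrite size_deriv_char0 // (size_fpoly PE tr) /= prednK // -ltnS -(size_fpoly PE tr); move: s2; case: (size _) => // -[].
Qed.

End Minor.


(** * Roots of P at which Q has degree 0 *)

Section Proportional.
Variable K : closedFieldType.
Hypothesis charK : [pchar K] =i pred0.
Variables (P Q : {poly {poly K}}) (rootsP rootsQ : seq (puiseux K)) (c : K).
Hypothesis PE : has_roots P rootsP.
Hypothesis QE : has_roots Q rootsQ.
Hypothesis jacPQ : jac P Q = c%:P%:P.
Variables (m n d : nat).
Hypothesis m_gt1 : (1 < m)%N.
Hypothesis n_gt0 : (0 < n)%N.
Hypothesis co_mn : coprime m n.
Hypothesis d_gt0 : (0 < d)%N.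
Hypothesis sizeP : size rootsP = (m * d)%N.
Hypothesis sizeQ : size rootsQ = (n * d)%N.
Variable alpha : puiseux K.
Hypothesis alphaP : alpha \in rootsP.
Hypothesis degQ : pdeg (ev Q alpha) = 0.

Lemma mu_gt0 t : (0 < mu alpha t rootsP)%N.
Proof. by rewrite -has_count; apply/hasP; exists alpha => //; rewrite /closer eqxx. Qed.

(** While both levels are positive, the bracket at [alpha] forces
    [lambda_P f g' = lambda_Q f' g]: otherwise [g] would not vanish at [alpha]
    and Q would have positive degree there. *)
Lemma proportional_mu t : 0 < Lev alpha t rootsP ->
  n%:R * Lev alpha t rootsP = m%:R * Lev alpha t rootsQ ->
  (n * mu alpha t rootsP = m * mu alpha t rootsQ)%N.
Proof.
move=> LP0 prop; set tau := approx alpha t.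
have tr : truncated tau := @approx_truncated _ _ _.
have ag : agrees alpha tau := @agrees_approx _ _ _.
have m0 : 0 < m%:R :> rat by rewrite ltr0n ltnW.
have n0 : 0 < n%:R :> rat by rewrite ltr0n.
have LQ0 : 0 < Lev alpha t rootsQ by rewrite -(pmulr_rgt0 _ m0) -prop pmulr_rgt0.
have lP : lambda P tau = Lev alpha t rootsP := lambdaE PE tr ag.
have lQ : lambda Q tau = Lev alpha t rootsQ := lambdaE QE tr ag.
have [Ple _] := fpolyP PE tr; have [Qle _] := fpolyP QE tr.
have [k] := bracket_top charK jacPQ Ple Qle; rewrite -/(fpoly P tau) -/(fpoly Q tau).
have [f f0 fE] := fpoly_multiplicity alpha t PE.
have [g g0 gE] := fpoly_multiplicity alpha t QE.
have fr : (fpoly P tau).[alpha t] = 0.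
  apply/rootP; apply: (root_fpoly (alpha := alpha) PE tr).
  by rewrite mem_Dtau alphaP andbT; apply/asboolP.
have gr : (fpoly Q tau).[alpha t] = 0.
  have [le E] := ev_top tr ag Qle; apply/eqP/negPn/negP => gr.
  have : pdeg (ev Q alpha) = lambda Q tau by apply: pdeg_eq; rewrite ?E.
  by rewrite degQ lQ => E0; move: LQ0; rewrite -E0 ltxx.
move=> H; have k0 : k = 0.
  have := congr1 (horner^~ (alpha t)) H.
  by rewrite /= !(hornerD, hornerN, hornerM, hornerC) fr gr !(mulr0, mul0r) subr0.
move: H; rewrite k0 polyC0 fE gE => /(multiplicity_relation f0 g0).
rewrite -!ratr_char0Mn // => /(ratr_char0_inj charK); rewrite lP lQ => H.
apply/eqP; rewrite -(eqr_nat rat) !natrM; apply/eqP.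
apply: (mulIf (lt0r_neq0 LP0)).
by rewrite mulrAC prop -mulrA -H; ring.
Qed.

(** A common denominator [l] for the exponents at which roots separate from
    [alpha], and a bound [N] on them: between two points of the grid
    N - i / l no root separates. *)
Lemma gap_exponents : exists l N : nat, [/\ (0 < l)%N, (0 < N)%N &
  forall beta, beta \in rootsP ++ rootsQ -> alpha != beta ->
    pdeg (alpha - beta) <= N%:R /\ pdeg (alpha - beta) * l%:R \is a Num.int].
Proof.
elim: (rootsP ++ rootsQ) => [|b s [l [N [l0 N0 H]]]]; first by exists 1%N, 1%N.
set e := pdeg (alpha - b).
exists (l * `|denq e|)%N, (N + `|Num.ceil e|)%N; split.
- by rewrite muln_gt0 l0 absz_gt0 denq_neq0.
- by rewrite addn_gt0 N0.
move=> beta; rewrite inE => /orP[/eqP -> _|bs ne]; rewrite -/e natrM natrD.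
  split.
    rewrite (le_trans (ceil_ge e)) // -[leLHS]add0r lerD ?ler0n //.
    rewrite natr_absz ler_int; exact: ler_norm.
  rewrite mulrCA rpredM //; first by rewrite intr_nat // natr_nat.
  by rewrite natr_absz gtr0_norm ?denq_gt0 // -numqE; apply/intrP; exists (numq e).
have [le it] := H _ bs ne; split; first by rewrite (le_trans le) // lerDl ler0n.
by rewrite mulrA rpredM // intr_nat // natr_nat.
Qed.

(** The descent reaches level 0 with the number of roots near [alpha] still a
    multiple of m, so the leading polynomial there has degree at least 2. *)
Lemma level0_proportional : exists j, Lev alpha j rootsP = 0 /\
  (1 < size (Dtau rootsP (approx alpha j)))%N.
Proof.
have [l [N [l0 N0 H]]] := gap_exponents.
have l0' : 0 < l%:R :> rat by rewrite ltr0n.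
have lne : l%:R != 0 :> rat by rewrite gt_eqF.
have lV : 0 < l%:R^-1 :> rat by rewrite invr_gt0.
pose t i : rat := N%:R - i%:R / l%:R.
have tS i : t i.+1 = t i - l%:R^-1 by rewrite /t -natr1 mulrDl mul1r opprD addrA.
have tlt i : t i.+1 < t i by rewrite tS; lra.
have gap rs i : {subset rs <= rootsP ++ rootsQ} -> forall beta, beta \in rs -> alpha != beta ->
    pdeg (alpha - beta) <= t i.+1 \/ t i <= pdeg (alpha - beta).
  move=> sub beta /sub brs ne; have [_ it] := H _ brs ne.
  have [lt|] := ltP (pdeg (alpha - beta)) (t i); [left|by right].
  move/intrP: it => [z zE].
  have eE : pdeg (alpha - beta) = z%:~R / l%:R by rewrite -zE mulfK // gt_eqF.
  have tE k : t k = ((N * l)%:Z - k%:Z)%:~R / l%:R.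
    by rewrite /t rmorphB /= -!pmulrn natrM; field.
  move: lt; rewrite eE !tE ltr_pM2r // ler_pM2r // ltr_int ler_int; lia.
have subP : {subset rootsP <= rootsP ++ rootsQ} by move=> b bP; rewrite mem_cat bP.
have subQ : {subset rootsQ <= rootsP ++ rootsQ} by move=> b bQ; rewrite mem_cat bQ orbT.
have seg rs i j : {subset rs <= rootsP ++ rootsQ} -> t i.+1 <= j < t i ->
    Lev alpha j rs = Lev alpha (t i) rs - (t i - j) * (mu alpha (t i) rs)%:R /\
    size (Dtau rs (approx alpha j)) = mu alpha (t i) rs.
  by move=> sub jt; apply: Lev_segment jt _; apply: gap.
have stepE rs i : {subset rs <= rootsP ++ rootsQ} ->
    Lev alpha (t i.+1) rs = Lev alpha (t i) rs - l%:R^-1 * (mu alpha (t i) rs)%:R.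
  move=> sub; have [|-> _] := seg rs i (t i.+1) sub; first by rewrite lexx tlt.
  by rewrite tS; congr (_ - _ * _); ring.
have Lev0 rs : {subset rs <= rootsP ++ rootsQ} -> Lev alpha (t 0%N) rs = N%:R * (size rs)%:R.
  have -> : t 0%N = N%:R by rewrite /t mul0r subr0.
  elim: rs => [|b rs IH] sub; first by rewrite /Lev big_nil mulr0.
  rewrite /Lev big_cons -/(Lev _ _ _) IH => [|x xs]; last by apply: sub; rewrite inE xs orbT.
  have -> : lev alpha N%:R b = N%:R.
    rewrite /lev; case: eqVneq => // ne.
    by have [le _] := H b (sub _ (mem_head _ _)) ne; apply/max_idPl.
  by rewrite /= -natr1; ring.
have LPpos : 0 < Lev alpha (t 0%N) rootsP.
  by rewrite Lev0 // sizeP mulr_gt0 ?ltr0n // muln_gt0 d_gt0 ltnW.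
have prop i : 0 < Lev alpha (t i) rootsP ->
    n%:R * Lev alpha (t i) rootsP = m%:R * Lev alpha (t i) rootsQ.
  elim: i => [|i IH]; first by rewrite !Lev0 // sizeP sizeQ !natrM => _; ring.
  rewrite !stepE // => pos.
  have pos' : 0 < Lev alpha (t i) rootsP.
    by apply: lt_le_trans pos _; rewrite gerBl mulr_ge0 // ltW.
  have /(congr1 (fun k : nat => k%:R : rat)) := proportional_mu pos' (IH pos').
  by rewrite !natrM => E; rewrite !mulrBr IH // mulrCA E mulrCA.
have exneg : exists i, Lev alpha (t i) rootsP <= 0.
  have dec i : Lev alpha (t i) rootsP <= Lev alpha (t 0%N) rootsP - i%:R / l%:R.
    elim: i => [|i IH]; first by rewrite mul0r subr0.
    rewrite stepE //; have : 1 <= (mu alpha (t i) rootsP)%:R :> rat by rewrite ler1n mu_gt0.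
    rewrite -(ler_pM2l lV) mulr1 => mu1; rewrite -natr1 mulrDl mul1r; lra.
  exists (l * (N * (m * d)))%N; apply: (le_trans (dec _)).
  rewrite Lev0 // sizeP -natrM !natrM.
  have -> : l%:R * (N%:R * (m%:R * d%:R)) / l%:R = N%:R * (m%:R * d%:R) :> rat.
    by field.
  by rewrite subrr.
case: (ex_minnP exneg) => -[|i] neg mini; first by move: neg; rewrite leNgt LPpos.
have pos : 0 < Lev alpha (t i) rootsP.
  by rewrite ltNge; apply/negP => /mini; rewrite ltnn.
have muE := proportional_mu pos (prop _ pos).
have mdiv : (m %| mu alpha (t i) rootsP)%N.
  by rewrite -(Gauss_dvdr _ co_mn) muE dvdn_mulr.
have mu0 : 0 < (mu alpha (t i) rootsP)%:R :> rat by rewrite ltr0n mu_gt0.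
(* The zero of the affine function that the level is on this interval. *)
pose j := t i - Lev alpha (t i) rootsP / (mu alpha (t i) rootsP)%:R.
have jt : t i.+1 <= j < t i.
  apply/andP; split; last by rewrite /j gtrBl divr_gt0.
  rewrite tS lerD2l lerN2 ler_pdivrMr //; move: neg; rewrite stepE // subr_le0; exact.
have [LE DE] := seg rootsP i j subP jt; exists j; split.
  by rewrite LE /j subKr mulfVK ?subrr // gt_eqF.
by rewrite DE; apply: leq_trans m_gt1 _; apply: dvdn_leq => //; apply: mu_gt0.
Qed.

(** Genericity supplies simplicity of the leading polynomial at level 0. *)
Lemma degree0_minor :
  (forall tau, pi_root rootsP tau -> lambda P tau = 0 -> no_multiple_root (fpoly P tau)) ->
  exists2 tau, minor_pi_root P rootsP tau & agrees alpha tau.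
Proof.
move=> gen; have [j [LE D2]] := level0_proportional.
have tr := @approx_truncated _ alpha j; have ag := @agrees_approx _ alpha j.
have lam : lambda P (approx alpha j) = 0 by rewrite (lambdaE PE tr ag).
have pr : pi_root rootsP (approx alpha j).
  by split=> // E; move: D2; rewrite E.
exists (approx alpha j) => //; split=> //; split=> //; first exact: gen.
by rewrite (size_fpoly PE tr).
Qed.

End Proportional.


(** * Summing over the roots *)

Section DegreeOfDerivatives.
Variable K : closedFieldType.
Hypothesis charK : [pchar K] =i pred0.

Lemma pdeg_euler (f : puiseux K) : f != 0 -> pdeg f != 0 ->
  pdeg (euler (@ratr K) f) = pdeg f.
Proof.
move=> f0 d0; have [lead le] := pdegP f0; apply: pdeg_eq; last exact: pdle_euler.
by rewrite eulerE mulf_neq0 // ratr_char0_eq0.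
Qed.

Lemma pdegN (f : puiseux K) : pdeg (- f) = pdeg f.
Proof.
have [->|f0] := eqVneq f 0; first by rewrite oppr0.
by have [_] := pdeg_exprN1 1 f0; rewrite expr1 mulN1r.
Qed.

Lemma pchar_poly : [pchar {poly K}] =i pred0.
Proof.
by apply/(pcharf0P _).2 => k; rewrite -polyC_natr polyC_eq0 natr_char0_eq0.
Qed.

Lemma root_multiset_monic (F : {poly {poly K}}) rs : F \is monic -> root_multiset F rs ->
  has_roots F rs.
Proof.
move=> Fm; rewrite /root_multiset /has_roots => E; rewrite {1}E.
rewrite lead_coef_map_inj ?raddf0 //; last exact: pofpoly_inj.
by rewrite (monicP Fm) rmorph1 mul1r.
Qed.

Lemma size_has_roots (F : {poly {poly K}}) rs : has_roots F rs -> size F = (size rs).+1.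
Proof.
move=> FE; rewrite -(size_map_inj_poly (@pofpoly_inj K)) ?raddf0 // FE.
exact: size_prod_XsubC.
Qed.

Lemma ev_root (F : {poly {poly K}}) rs alpha : has_roots F rs -> alpha \in rs -> ev F alpha = 0.
Proof. by move=> FE aF; rewrite (ev_prod _ FE) (big_rem _ aF) /= subrr mul0r. Qed.

End DegreeOfDerivatives.

Section Assembly.
Variable K : closedFieldType.
Hypothesis charK : [pchar K] =i pred0.
Variables (P Q : {poly {poly K}}) (rootsP rootsQ : seq (puiseux K)) (c : K).
Hypothesis Pm : P \is monic.
Hypothesis PE : has_roots P rootsP.
Hypothesis QE : has_roots Q rootsQ.
Hypothesis c0 : c != 0.
Hypothesis jacPQ : jac P Q = c%:P%:P.
Hypothesis genericPQ : forall tau, pi_root rootsP tau -> lambda P tau = 0 ->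
  no_multiple_root (fpoly P tau) /\ coprimep (fpoly P tau) (fpoly Q tau).
Variables (m n d : nat).
Hypothesis m_gt1 : (1 < m)%N.
Hypothesis n_gt0 : (0 < n)%N.
Hypothesis co_mn : coprime m n.
Hypothesis d_gt0 : (0 < d)%N.
Hypothesis sizeP : size rootsP = (m * d)%N.
Hypothesis sizeQ : size rootsQ = (n * d)%N.

Implicit Types (alpha beta gamma : puiseux K) (tau : pi_approx K).

Local Notation minor := (minor_pi_root P rootsP).

(** A minor pi-root is determined by any root of P in its ball, which bounds
    their number. *)
Lemma minor_enumeration : exists T : seq (pi_approx K),
  uniq T /\ forall tau, (tau \in T) <-> minor tau.
Proof.
pose pick alpha : option (pi_approx K) :=
  if pselect (exists tau, minor tau /\ agrees alpha tau) is left h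
  then Some (projT1 (cid h)) else None.
have pickP alpha tau : pick alpha = Some tau -> minor tau.
  by rewrite /pick; case: pselect => // h [<-]; case: cid => ? [].
exists (undup (pmap pick rootsP)); split=> [|tau]; first exact: undup_uniq.
rewrite mem_undup mem_pmap; split=> [/mapP[alpha _] /esym/pickP //|mt].
case: (mt) => [[[_ Dne] _ _] _]; case D: (Dtau rootsP tau) Dne => [//|alpha s] _.
have : alpha \in Dtau rootsP tau by rewrite D mem_head.
rewrite mem_Dtau => /andP[/asboolP ag aP]; apply/mapP; exists alpha => //.
rewrite /pick; case: pselect => [h|[]]; last by exists tau.
by case: cid => tau' /= [mt' ag']; rewrite (minor_unique PE mt mt' ag ag').
Qed.

Section Weights.
Variable T : seq (pi_approx K).
Hypothesis uniqT : uniq T.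
Hypothesis memT : forall tau, (tau \in T) <-> minor tau.

(** Distinct minor pi-roots have disjoint balls, so at most one term occurs; the
    sum over a list of series then distributes over the minor pi-roots. *)
Definition weight gamma : rat := \sum_(tau <- T | `[< agrees gamma tau >]) (1 + tau.2).

Lemma weight_minor tau gamma : minor tau -> agrees gamma tau -> weight gamma = 1 + tau.2.
Proof.
move=> mt ag; have tT := (memT tau).2 mt.
rewrite /weight big_mkcond (bigD1_seq tau) //=; case: asboolP => // _.
rewrite big1_seq ?addr0 // => tau' /andP[ne t'T]; case: asboolP => // ag'.
by case/eqP: ne; apply: (minor_unique PE _ mt ag' ag); apply/memT.
Qed.

Lemma weight_none gamma : ~ (exists2 tau, minor tau & agrees gamma tau) -> weight gamma = 0.
Proof.
move=> none; rewrite /weight big1_seq // => tau /andP[/asboolP ag tT].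
by case: none; exists tau => //; apply/memT.
Qed.

Lemma sum_weight rs : \sum_(gamma <- rs) weight gamma =
  \sum_(tau <- T) (size (Dtau rs tau))%:R * (1 + tau.2).
Proof.
rewrite /weight; under eq_bigr do rewrite big_mkcond.
rewrite exchange_big /=; apply: eq_bigr => tau _.
rewrite -big_mkcond -big_filter -/(Dtau rs tau) big_const_seq count_predT iter_addr_0.
by rewrite mulr_natl.
Qed.

Lemma jac_ev_neq0 alpha : alpha \in rootsP ->
  [/\ ev (dy P) alpha != 0, ev Q alpha != 0 & euler (@ratr K) (ev Q alpha) != 0].
Proof.
move=> aP; have := jac_ev charK jacPQ (ev_root PE aP) => E.
have : ev (dy P) alpha * euler (@ratr K) (ev Q alpha) != 0.
  by rewrite E oppr_eq0 pmono_neq0.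
rewrite mulf_eq0 negb_or => /andP[u0 v0]; split=> //.
by apply: contraNneq v0 => ->; rewrite raddf0.
Qed.

Lemma pdeg_at_root alpha : alpha \in rootsP ->
  pdeg (ev (dy P) alpha) + pdeg (ev Q alpha) = 1 - weight alpha.
Proof.
move=> aP; have [u0 v0 tv0] := jac_ev_neq0 aP.
have [[tau mt ag]|none] := pselect (exists2 tau, minor tau & agrees alpha tau).
  have aD : alpha \in Dtau rootsP tau by rewrite mem_Dtau aP andbT; apply/asboolP.
  rewrite (weight_minor mt ag) (minor_ev_dyP PE mt aD).
  by rewrite (minor_ev_Q charK PE QE jacPQ genericPQ mt aD); ring.
have dQ : pdeg (ev Q alpha) != 0.
  apply/eqP => dQ; apply: none.
  apply: (degree0_minor charK PE QE jacPQ m_gt1 n_gt0 co_mn d_gt0 sizeP sizeQ aP dQ).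
  by move=> tau pr lam; have [] := genericPQ pr lam.
rewrite (weight_none none) subr0 -(pdeg_euler charK v0 dQ) -pdegM //.
by rewrite (jac_ev charK jacPQ (ev_root PE aP)) pdegN pdeg_mono.
Qed.

Lemma rootsP_neq0 : rootsP != [::].
Proof. by rewrite -size_eq0 sizeP -lt0n muln_gt0 d_gt0 ltnW. Qed.

(** Off the minor balls the bound is an equality, by differentiating P(beta);
    inside them P(beta) has degree 0 and the bound on Q_y(beta) makes up for
    the weight. *)
Lemma pdeg_at_critical beta : ev (dy P) beta = 0 ->
  [/\ ev P beta != 0, ev (dy Q) beta != 0 &
      pdeg (ev P beta) <= 1 - pdeg (ev (dy Q) beta) - weight beta].
Proof.
move=> crit; have [E1 E2] := jac_ev_dy charK jacPQ crit.
have : ev (dx P) beta * ev (dy Q) beta != 0 by rewrite E2 pmono_neq0.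
rewrite mulf_eq0 negb_or => /andP[x0 y0].
have dE : pdeg (ev (dx P) beta) = - pdeg (ev (dy Q) beta).
  by apply/eqP; rewrite -addr_eq0 -pdegM // E2 pdeg_mono.
have m0 : pmono 1 1 != 0 :> puiseux K by rewrite pmono_neq0 ?oner_neq0.
have tP0 : euler (@ratr K) (ev P beta) != 0 by rewrite E1 mulf_neq0.
have P0 : ev P beta != 0 by apply: contraNneq tP0 => ->; rewrite raddf0.
split=> //.
have [[tau mt ag]|none] := pselect (exists2 tau, minor tau & agrees beta tau).
  have [-> le] := minor_critical charK PE QE jacPQ mt ag crit.
  rewrite (weight_minor mt ag); have := pdeg_le y0 le; lra.
have dP : pdeg (ev P beta) != 0.
  apply/eqP => dP; apply: none.
  exact: (critical_minor charK PE genericPQ rootsP_neq0 crit P0 dP).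
rewrite (weight_none none) subr0 -(pdeg_euler charK P0 dP) E1 pdegM //.
by rewrite pdeg_mono ?oner_neq0 // dE.
Qed.

End Weights.

Lemma dyP_roots : (size rootsP)%:R^-1%:P *: dy P \is monic /\
  exists rs, has_roots ((size rootsP)%:R^-1%:P *: dy P) rs /\ (size rs).+1 = size rootsP.
Proof.
have N0 : (size rootsP)%:R != 0 :> K.
  by rewrite natr_char0_eq0 // size_eq0 rootsP_neq0.
have sP := size_has_roots PE.
have sdP : size (dy P) = size rootsP.
  by rewrite (size_deriv_char0 _ (pchar_poly charK)) // sP.
set F := _ *: _.
have sF : size F = size rootsP by rewrite size_scale ?sdP // polyC_eq0 invr_eq0.
have Fm : F \is monic.
  rewrite monicE lead_coefE sF coefZ coef_deriv prednK; last first.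
    by rewrite lt0n size_eq0 rootsP_neq0.
  have -> : P`_(size rootsP) = 1 by move: Pm; rewrite monicE lead_coefE sP => /eqP.
  by rewrite -polyC_natr -polyCM mulVf.
have Fm' : map_poly (@pofpoly K) F \is monic.
  rewrite monicE lead_coef_map_inj ?raddf0 //; last exact: pofpoly_inj.
  by rewrite (monicP Fm) rmorph1.
have [rs E] := newton_puiseux charK Fm'; split=> //; exists rs; split=> //.
by rewrite -(size_has_roots E).
Qed.

Lemma intersection_bounds :
  let PM := [set tau : pi_approx K | minor tau] in
  1 - \sum_(tau \in PM) (pi_order tau + 1) <= (intersection_number P Q)%:R /\
  (intersection_number P (dy P * Q))%:R =
    (size P).-1%:R -
    \sum_(tau \in PM) (size (Dtau rootsP tau))%:R * (1 + pi_order tau) :> rat.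
Proof.
have [T [uT memT]] := minor_enumeration; move=> PM.
have PME : PM = [set` T].
  by apply/seteqP; split=> tau /memT.
rewrite PME -!fsbig_seq //.
have [Fm [rs [RE sR]]] := dyP_roots.
have N0 : (size rootsP)%:R^-1 != 0 :> K.
  by rewrite invr_eq0 natr_char0_eq0 // size_eq0 rootsP_neq0.
have evF F gamma (k : K) : ev (k%:P *: F) gamma = pmono 0 k * ev F gamma.
  by rewrite -mul_polyC evM evC.
have k0 : pmono 0 (size rootsP)%:R^-1 != 0 :> puiseux K by rewrite pmono_neq0.
have crit beta : beta \in rs -> ev (dy P) beta = 0.
  move=> /(ev_root RE) /eqP; rewrite evF mulf_eq0 (negPf k0) /= => /eqP //.
have sP := size_has_roots PE.
have Q0 : Q != 0 by rewrite -size_poly_gt0 (size_has_roots QE).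
have dQ0 : dy Q != 0.
  rewrite -size_poly_gt0 size_deriv_char0; last exact: pchar_poly.
  by rewrite (size_has_roots QE) sizeQ muln_gt0 n_gt0.
have dP0 : dy P != 0.
  rewrite -size_poly_gt0 size_deriv_char0; last exact: pchar_poly.
  by rewrite sP /= lt0n size_eq0 rootsP_neq0.
have I1 : (intersection_number P Q)%:R = \sum_(alpha <- rootsP) pdeg (ev Q alpha).
  by apply: pdeg_resultant => // alpha /jac_ev_neq0[].
have I2 : (intersection_number P (dy P * Q))%:R =
    \sum_(alpha <- rootsP) (1 - weight T alpha).
  rewrite (pdeg_resultant charK Pm PE); last 2 first.
  - exact: mulf_neq0.
  - by move=> alpha /jac_ev_neq0[u0 v0 _]; rewrite evM mulf_neq0.
  rewrite !big_seq; apply: eq_bigr => alpha aP.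
  have [u0 v0 _] := jac_ev_neq0 aP.
  by rewrite evM pdegM // (pdeg_at_root uT memT).
have I2' : (intersection_number P (dy P * Q))%:R = (size rootsP)%:R - \sum_(alpha <- rootsP) weight T alpha.
  by rewrite I2 sumrB big_const_seq count_predT iter_addr_0.
split; last by rewrite I2' sum_weight sP.
(* Both sums are the total degree of the differences alpha - beta. *)
have sumdP : \sum_(alpha <- rootsP) pdeg (ev (dy P) alpha) = \sum_(beta <- rs) pdeg (ev P beta).
  have E1 alpha : alpha \in rootsP -> pdeg (ev (dy P) alpha) = \sum_(beta <- rs) pdeg (alpha - beta).
    move=> aP; have [u0 _ _] := jac_ev_neq0 aP.
    have u0' : ev ((size rootsP)%:R^-1%:P *: dy P) alpha != 0 by rewrite evF mulf_neq0.
    transitivity (pdeg (ev ((size rootsP)%:R^-1%:P *: dy P) alpha)).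
      by rewrite evF pdegM // pdeg_mono // add0r.
    move: u0'; rewrite (ev_prod _ RE) => u0'; apply: pdeg_prod => beta bR.
    by apply: contraNneq u0' => E; rewrite (big_rem _ bR) /= E mul0r.
  have E2 beta : beta \in rs -> pdeg (ev P beta) = \sum_(alpha <- rootsP) pdeg (alpha - beta).
    move=> /crit/(pdeg_at_critical uT memT)[P0 _ _]; move: P0; rewrite (ev_prod _ PE) => P0.
    rewrite pdeg_prod => [|alpha aP].
      by apply: eq_bigr => alpha _; rewrite -pdegN opprB.
    by apply: contraNneq P0 => E; rewrite (big_rem _ aP) /= E mul0r.
  rewrite [LHS]big_seq (eq_bigr _ E1) -big_seq exchange_big /=.
  by rewrite [RHS]big_seq [RHS](eq_bigr _ E2) -big_seq.
have sumQ : \sum_(beta <- rs) pdeg (ev (dy Q) beta) >= 0.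
  rewrite -(pdeg_resultant charK Fm RE dQ0) ?ler0n //.
  by move=> beta /crit/(pdeg_at_critical uT memT)[].
have sumP : \sum_(beta <- rs) pdeg (ev P beta) <=
    \sum_(beta <- rs) (1 - pdeg (ev (dy Q) beta) - weight T beta).
  rewrite !big_seq; apply: ler_sum => beta /crit/(pdeg_at_critical uT memT)[].
  by [].
have sizes : \sum_(alpha <- rootsP) weight T alpha - \sum_(beta <- rs) weight T beta =
    \sum_(tau <- T) (tau.2 + 1).
  rewrite !sum_weight -sumrB !big_seq; apply: eq_bigr => tau /memT mt.
  rewrite -mulrBl (size_Dtau_dy charK PE mt N0 RE).
  have : (0 < size (Dtau rootsP tau))%N.
    by case: (mt) => [[[_ Dne] _ _] _]; case: (Dtau _ _) Dne.
  by case: (size _) => // k _; rewrite -natr1 addrAC subrr add0r mul1r addrC.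
have I12 : \sum_(alpha <- rootsP) pdeg (ev Q alpha) =
    (size rootsP)%:R - \sum_(alpha <- rootsP) weight T alpha - \sum_(beta <- rs) pdeg (ev P beta).
  rewrite -I2' I2 -sumdP -sumrB !big_seq; apply: eq_bigr => alpha aP.
  by rewrite -(pdeg_at_root uT memT aP); ring.
rewrite I1 I12 /pi_order -sizes.
move: sumP; rewrite !sumrB big_const_seq count_predT iter_addr_0 => sumP.
have : (size rootsP)%:R = 1 + (size rs)%:R :> rat by rewrite -sR -natr1 addrC.
lra.
Qed.

End Assembly.


(** * The change of coordinates x -> x + y *)

Section Shear.
Variable K : fieldType.
Implicit Types (F G : {poly {poly K}}).

Lemma coef_dx F i : (dx F)`_i = (F`_i)^`().
Proof. by rewrite /dx coef_map_id0 ?deriv0. Qed.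

Lemma dxD F G : dx (F + G) = dx F + dx G.
Proof. by apply/polyP => i; rewrite coefD !coef_dx coefD derivD. Qed.

Lemma dxM F G : dx (F * G) = dx F * G + F * dx G.
Proof.
apply/polyP => i; rewrite coefD coef_dx !coefM (raddf_sum (@deriv K)) -big_split /=.
by apply: eq_bigr => j _; rewrite derivM !coef_dx.
Qed.

Lemma dxC (c : {poly K}) : dx c%:P = (c^`())%:P.
Proof. by apply/polyP => i; rewrite coef_dx !coefC; case: eqP; rewrite ?deriv0. Qed.

Lemma dx_xvar : dx (xvar K) = 1.
Proof. by rewrite dxC derivX. Qed.

Lemma dx_yvar : dx (yvar K) = 0.
Proof.
apply/polyP => i; rewrite coef_dx coefX coef0.
by case: (i == 1)%N; rewrite ?deriv0 // -polyC1 derivC.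
Qed.

Definition shear_coef : {rmorphism {poly K} -> {poly {poly K}}} :=
  horner_eval (xvar K + yvar K) \o map_poly (@polyC {poly K} \o @polyC K).

Definition shear F : {poly {poly K}} := (map_poly shear_coef F).[yvar K].

Lemma shearE F : subst2 (xvar K + yvar K) (yvar K) F = shear F.
Proof. by []. Qed.

Section ShearDerivation.

(* Both partial derivatives send x + y to 1; they differ on y only. *)
Variable D : {poly {poly K}} -> {poly {poly K}}.
Hypothesis D0 : D 0 = 0.
Hypothesis DD : forall F G, D (F + G) = D F + D G.
Hypothesis DM : forall F G, D (F * G) = D F * G + F * D G.
Hypothesis DC : forall k : K, D k%:P%:P = 0.
Hypothesis Dxy : D (xvar K + yvar K) = 1.

Lemma derivation_shear F : D (shear F) = shear (dx F) + shear (dy F) * D (yvar K).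
Proof.
apply: derivation_horner => // [|c]; first exact: deriv0.
rewrite /= /horner_eval (@derivation_horner _ _ _ (fun _ => 0)) // ?Dxy ?mulr1.
rewrite [map_poly (fun _ => 0) c](_ : _ = 0) ?rmorph0 ?horner0 ?add0r //.
by apply/polyP => i; rewrite coef_map_id0 ?coef0.
Qed.

End ShearDerivation.

Lemma dx_shear F : dx (shear F) = shear (dx F).
Proof.
rewrite derivation_shear ?dx_yvar ?mulr0 ?addr0 //.
- by rewrite -[0 in LHS]polyC0 dxC deriv0.
- exact: dxD.
- exact: dxM.
- by move=> k; rewrite dxC derivC.
- by rewrite dxD dx_xvar dx_yvar addr0.
Qed.

Lemma dy_shear F : dy (shear F) = shear (dx F) + shear (dy F).
Proof.
rewrite (@derivation_shear (@dy K)) /dy ?derivX ?mulr1 //.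
- exact: deriv0.
- exact: derivD.
- exact: derivM.
- by move=> k; rewrite derivC.
- by rewrite derivD derivC derivX add0r.
Qed.

Lemma shearM F G : shear (F * G) = shear F * shear G.
Proof. by rewrite /shear rmorphM hornerM. Qed.

Lemma shearB F G : shear (F - G) = shear F - shear G.
Proof. by rewrite /shear rmorphB hornerD hornerN. Qed.

Lemma shearC (k : K) : shear k%:P%:P = k%:P%:P.
Proof. by rewrite /shear map_polyC hornerC /= map_polyC /horner_eval hornerC. Qed.

Lemma jac_shear F G (k c : K) : jac F G = k%:P%:P ->
  jac (shear F + c%:P%:P) (shear G) = k%:P%:P.
Proof.
move=> J; have dC : dx (shear F + c%:P%:P) = dx (shear F).
  by rewrite dxD dxC derivC polyC0 addr0.
have dC' : dy (shear F + c%:P%:P) = dy (shear F) by rewrite /dy derivD derivC addr0.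
rewrite /jac dC dC' !dx_shear !dy_shear -[RHS]shearC -J /jac shearB !shearM; ring.
Qed.

End Shear.

(** * The leading form and the degree in y *)

Section LeadingForm.
Variable K : fieldType.
Implicit Types (F G : {poly {poly K}}).

Lemma mem_supp F i j : ((i, j) \in supp F) = (F`_j`_i != 0).
Proof.
apply/allpairsPdep/idP => [[j' [i' [_]]]|ne].
  by rewrite mem_filter => /andP[ne _] [-> ->].
have js : (j < size F)%N.
  by rewrite ltnNge; apply: contraNN ne => /(nth_default 0) ->; rewrite coef0.
have is_ : (i < size (F`_j)%R)%N.
  by rewrite ltnNge; apply: contraNN ne => /(nth_default 0) ->.
by exists j, i; rewrite mem_filter !mem_iota ne.
Qed.

Lemma supp_uniq F : uniq (supp F).
Proof.
apply: allpairs_uniq_dep => [|j _|]; first exact: iota_uniq.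
  by rewrite filter_uniq // iota_uniq.
by move=> [j i] [j' i'] _ _ /= [-> ->].
Qed.

Lemma vpt_le_val F p : p \in supp F -> vpt 1 1 p <= Defs.val 1 1 F.
Proof.
move=> /(map_f (vpt 1 1)); rewrite /Defs.val /=.
move: [seq vpt 1 1 q | q <- supp F] => vs; move: (head 0 vs) => h.
elim: vs h => // v vs IH h; rewrite inE big_cons le_max => /orP[/eqP ->|/IH].
  by rewrite lexx.
by move=> ->; rewrite orbT.
Qed.

Lemma coef_monomial (e : K) i j k l :
  (e%:P%:P * xvar K ^+ i * yvar K ^+ j)`_k`_l = if (l == i) && (k == j) then e else 0.
Proof.
rewrite /xvar /yvar -polyC_exp -polyCM coefCM coefXn.
case: eqP => _; rewrite ?mulr0 ?coef0 ?andbF // mulr1 andbT coefCM coefXn.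
by case: eqP; rewrite ?mulr1 ?mulr0.
Qed.

Lemma coef_ell F i j : (ell 1 1 F)`_j`_i =
  if (vpt 1 1 (i, j) == Defs.val 1 1 F) then F`_j`_i else 0.
Proof.
rewrite /ell !coef_sum; under eq_bigr => p _ do rewrite coef_monomial.
have [F0|F0] := eqVneq F`_j`_i 0.
  rewrite F0 if_same big1 // => -[i' j'] _ /=.
  by case: ifP => // /andP[/eqP <- /eqP <-].
rewrite big_mkcond (bigD1_seq (i, j)) ?supp_uniq ?mem_supp //= !eqxx big1 ?addr0 //.
move=> [i' j']; rewrite xpair_eqE negb_and => ne; case: ifP => // _.
by case: ifP => // /andP[/eqP E /eqP E']; move: ne; rewrite E E' !eqxx.
Qed.

(** The leading form determines the coefficients on the top antidiagonal, and all
    other points of the support lie strictly below it. *)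
Lemma leading_monomial F i0 j0 : ell 1 1 F = xvar K ^+ i0 * yvar K ^+ j0 ->
  F`_j0`_i0 = 1 /\ (forall i j, F`_j`_i != 0 ->
    (i + j < i0 + j0)%N \/ (i = i0 /\ j = j0)).
Proof.
move=> E; have cE i j : (ell 1 1 F)`_j`_i = if (i == i0) && (j == j0) then 1 else 0.
  by rewrite E -coef_monomial polyC1 mul1r.
have := cE i0 j0; rewrite coef_ell !eqxx; case: eqP => [vE F1|_ /eqP]; last first.
  by rewrite eq_sym oner_eq0.
split=> // i j ne; have := @vpt_le_val F (i, j); rewrite mem_supp ne => /(_ isT).
rewrite -vE /vpt !mul1r /= -!PoszD lez_nat leq_eqVlt => /orP[/eqP e|]; last by left.
right; have := cE i j; rewrite coef_ell.
have -> : vpt 1 1 (i, j) == Defs.val 1 1 F.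
  by rewrite -vE /vpt !mul1r -!PoszD e.
by case: ifP => [/andP[/eqP -> /eqP ->] //|_ F0]; move: ne; rewrite F0 eqxx.
Qed.

(** Each monomial x^i y^j becomes (x + y)^i y^j, monic in y of degree i + j. *)
Lemma shear_monic F i0 j0 (c : K) : (0 < i0 + j0)%N ->
  ell 1 1 F = xvar K ^+ i0 * yvar K ^+ j0 ->
  shear F + c%:P%:P \is monic /\ size (shear F + c%:P%:P) = (i0 + j0).+1.
Proof.
move=> d0 /leading_monomial[F1 Fle].
set A := xvar K + yvar K.
have Am : A \is monic by rewrite /A addrC -(opprK (xvar K)) /xvar -polyCN monicXsubC.
have sA : size A = 2 by rewrite /A addrC -(opprK (xvar K)) /xvar -polyCN size_XsubC.
pose M i j := A ^+ i * yvar K ^+ j.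
have Mm i j : M i j \is monic by rewrite rpredM ?monic_exp ?monicX.
have sA_exp i : size (A ^+ i) = i.+1.
  elim: i => [|i IH]; first by rewrite expr0 size_poly1.
  by rewrite exprS size_monicM // ?monic_neq0 ?monic_exp // sA IH.
have sM i j : size (M i j) = (i + j).+1.
  by rewrite size_Mmonic ?monicXn ?monic_neq0 ?monic_exp // sA_exp size_polyXn addnS.
have shE : shear F = \sum_(j < size F) \sum_(i < size F`_j) (F`_j`_i)%:P%:P * M i j.
  rewrite /shear /map_poly horner_poly; apply: eq_bigr => j _.
  rewrite /= /horner_eval /map_poly horner_poly mulr_suml; apply: eq_bigr => i _.
  by rewrite /M mulrA.
have coef_M i j k : (i + j < k)%N -> (M i j)`_k = 0.
  by move=> lt; rewrite nth_default // sM.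
have shk k : (i0 + j0 < k)%N -> (shear F)`_k = 0.
  move=> lt; rewrite shE coef_sum big1 // => j _; rewrite coef_sum big1 // => i _.
  rewrite coefCM; have [->|/Fle H] := eqVneq F`_j`_i 0; first by rewrite mul0r.
  by rewrite coef_M ?mulr0 //; case: H => [/ltn_trans|[-> ->] //]; apply.
have sh1 : (shear F)`_(i0 + j0) = 1.
  have j0s : (j0 < size F)%N.
    rewrite ltnNge; apply/negP => /(nth_default 0) E.
    by move/eqP: F1; rewrite E coef0 eq_sym oner_eq0.
  have i0s : (i0 < size (F`_j0)%R)%N.
    rewrite ltnNge; apply/negP => /(nth_default 0) E.
    by move/eqP: F1; rewrite E eq_sym oner_eq0.
  have other i j : (i, j) != (i0, j0) -> (F`_j`_i)%:P * (M i j)`_(i0 + j0) = 0.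
    move=> ne; have [->|/Fle[lt|[E E']]] := eqVneq F`_j`_i 0; first by rewrite mul0r.
      by rewrite coef_M ?mulr0.
    by move: ne; rewrite E E' eqxx.
  rewrite shE coef_sum (bigD1 (Ordinal j0s)) //= coef_sum (bigD1 (Ordinal i0s)) //=.
  rewrite coefCM F1 mul1r; have : M i0 j0 \is monic := Mm _ _.
  rewrite monicE lead_coefE sM => /eqP ->.
  rewrite !big1 ?addr0 // => [j nj|i ni].
    rewrite coef_sum big1 // => i _; rewrite coefCM other //.
    by rewrite xpair_eqE negb_and; apply/orP; right; move: nj; rewrite -val_eqE.
  by rewrite coefCM other // xpair_eqE eqxx andbT; move: ni; rewrite -val_eqE.
have c1 : (shear F + c%:P%:P)`_(i0 + j0) = 1.
  by rewrite coefD coefC gtn_eqF // addr0.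
have sz : size (shear F + c%:P%:P) = (i0 + j0).+1.
  apply/eqP; rewrite eqn_leq; apply/andP; split.
    apply/leq_sizeP => k lt; rewrite coefD coefC shk // gtn_eqF ?addr0 //.
    exact: leq_trans lt.
  rewrite ltnNge; apply/negP => /leq_sizeP/(_ _ (leqnn _)); rewrite c1 => /eqP.
  by rewrite oner_eq0.
by rewrite monicE lead_coefE sz c1.
Qed.

End LeadingForm.

Theorem theorem3p25 (K : closedFieldType) (charK : [pchar K] =i pred0)
  (m n a b : nat) (m_gt1 : (1 < m)%N) (n_gt1 : (1 < n)%N) (co_mn : coprime m n)
  (a_gt0 : (0 < a)%N) (lt_ab : (a < b)%N)
  (P0 Q0 : {poly {poly K}})
  (min0 : minimal_pair P0 Q0)
  (std0 : standard_pair m n P0 Q0)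
  (enP0 : en 1 0 P0 = (m * a, m * b)%N)
  (enQ0 : en 1 0 Q0 = (n * a, n * b)%N)
  (ellP0 : ell 1 1 P0 = xvar K ^+ (a * m) * yvar K ^+ (b * m))
  (ellQ0 : ell 1 1 Q0 = xvar K ^+ (a * n) * yvar K ^+ (b * n))
  (c : K) (P Q : {poly {poly K}})
  (defP : P = subst2 (xvar K + yvar K) (yvar K) P0 + c%:P%:P)
  (defQ : Q = subst2 (xvar K + yvar K) (yvar K) Q0)
  (rootsP rootsQ : seq (puiseux K))
  (rootsPP : root_multiset P rootsP) (rootsQP : root_multiset Q rootsQ)
  (generic : generic_pair P Q rootsP) :
  let Pm := [set tau : pi_approx K | minor_pi_root P rootsP tau] in
  let I_m : rat := 1 - \sum_(tau \in Pm) (pi_order tau + 1) in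
  I_m <= (intersection_number P Q)%:R /\
  (intersection_number P (dy P * Q))%:R =
    (size P).-1%:R -
    \sum_(tau \in Pm) (size (Dtau rootsP tau))%:R * (1 + pi_order tau) :> rat.
Proof.
have [[k k0 jac0] _ _ _ _] := std0; have [gen _] := generic.
have d_gt0 : (0 < a + b)%N by rewrite addn_gt0 a_gt0.
have pos q : (1 < q)%N -> (0 < a * q + b * q)%N.
  by move=> q1; rewrite -mulnDl muln_gt0 d_gt0 ltnW.
have [Pmon sP] := shear_monic c (pos m m_gt1) ellP0.
have [] := shear_monic 0 (pos n n_gt1) ellQ0; rewrite !polyC0 addr0 => Qmon sQ.
have jacPQ : jac P Q = k%:P%:P by rewrite defP defQ !shearE; apply: jac_shear.
rewrite -shearE -defP in Pmon sP; rewrite -shearE -defQ in Qmon sQ.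
have PE := root_multiset_monic Pmon rootsPP.
have QE := root_multiset_monic Qmon rootsQP.
have sizeP : size rootsP = (m * (a + b))%N.
  by apply: succn_inj; rewrite -(size_has_roots PE) sP -mulnDl mulnC.
have sizeQ : size rootsQ = (n * (a + b))%N.
  by apply: succn_inj; rewrite -(size_has_roots QE) sQ -mulnDl mulnC.
exact: (intersection_bounds charK Pmon PE QE k0 jacPQ gen m_gt1 (ltnW n_gt1) co_mn d_gt0 sizeP sizeQ).
Qed.
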